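(* Let $X$ be a sparse $2\times n$ matrix (in the normal form given in the context), $I$ the ideal of $2\times2$ minors of $X$, and $\tau$ a diagonal term order on $R=K[X]$. Then $\mathrm{in}_\tau(\mathcal{F}(I))=\mathcal{F}(\mathrm{in}_\tau(I))$. Moreover, the $2\times 2$ minors of $X$ are a SAGBI basis (with respect to $\tau$) of the $K$-algebra $\mathcal{F}(I)$, the Plücker relations $p_{ijkl}$, $1\le i<j<k<l\le n$, form a Gröbner basis (with respect to a suitable term order on $T$) for $\mathcal{K}=\ker(\varphi)$, and $\mathcal{F}(I)$ is a Koszul algebra.
   Context: $K$ is a field, $n\ge3$. A sparse matrix is a matrix whose entries are either zero or distinct indeterminates over $K$. Up to permuting rows and columns, it is assumed that there are integers $r,s$ with $r\ge1$, $s\ge 0$, $0\le n-r-s\le r<n$ such that $$X=\begin{pmatrix}x_{1,1}&\cdots&x_{1,r}&x_{1,r+1}&\cdots&x_{1,r+s}&0&\cdots&0\\0&\cdots&0&x_{2,r+1}&\cdots&x_{2,r+s}&x_{2,r+s+1}&\cdots&x_{2,n}\end{pmatrix}.$$ $R=K[X]$ is the polynomial ring over $K$ in the variables appearing in $X$; $f_{ij}$ is the $2\times2$ minor on columns $i<j$, and $I=(f_{ij}\mid 1\le i<j\le n)$. A diagonal term order on $R$ is a term order for which the leading term of each nonzero minor of $X$ is the product of the entries on its diagonal (so $f_{ij}\neq0$, $i<j$, has leading term $x_{1i}x_{2j}$). The special fiber ring of a homogeneous ideal $H\subseteq R$ is $\mathcal{F}(H)=\mathcal{R}(H)\otimes_R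 R/\mathfrak m$, where $\mathcal{R}(H)=\bigoplus_{i\ge0}H^it^i$ and $\mathfrak m$ is the homogeneous maximal ideal of $R$. Since $I$ and $\mathrm{in}_\tau(I)$ are generated in a single degree, identify $\mathcal{F}(I)=K[f_{ij}\mid 1\le i<j\le n]\subseteq R$ and $\mathcal{F}(\mathrm{in}_\tau(I))=K[\mathrm{in}_\tau(f_{ij})\mid f_{ij}\ne0]\subseteq R$ (standard graded, the displayed generators having degree $1$). For a $K$-subalgebra $A\subseteq R$, $\mathrm{in}_\tau(A)$ is the $K$-algebra generated by the initial monomials of the nonzero elements of $A$; $C\subseteq A$ is a SAGBI basis of $A$ if $\mathrm{in}_\tau(A)$ is generated as a $K$-algebra by the initial monomials of the nonzero elements of $C$. $T$ is the polynomial ring over $K$ in variables $y_{ij}$, one for each pair $i<j$ with $f_{ij}\ne0$; put $y_{ij}=0$ when $f_{ij}=0$, i.e. when $i,j\in\{1,\dots,r\}$ or $i,j\in\{r+s+1,\dots,n\}$. The map $\varphi:T\to\mathcal{F}(I)$ is given by $y_{ij}\mapsto f_{ij}$. The Plücker relations are $p_{ijkl}=y_{ij}y_{kl}-y_{ik}y_{jl}+y_{il}y_{jk}$. *)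

(* Defs.v *)
From mathcomp Require Import all_boot all_order all_algebra.
From mathcomp Require Import mpoly.

Set Implicit Arguments.
Unset Strict Implicit.
Unset Printing Implicit Defensive.

Import GRing.Theory.
Local Open Scope ring_scope.

(* Subsets of a polynomial ring are predicates to Prop, and an equality of
   subsets is stated elementwise. *)

Section PolynomialRing.

Variables (K : fieldType) (N : nat).
Implicit Types (S A C J : {mpoly K[N]} -> Prop) (le : rel 'X_{1..N}).

Inductive alg_gen S : {mpoly K[N]} -> Prop :=
  | alg_gen_in p of S p : alg_gen S p
  | alg_gen_cst c : alg_gen S c%:MP
  | alg_gen_add p q of alg_gen S p & alg_gen S q : alg_gen S (p + q)
  | alg_gen_mul p q of alg_gen S p & alg_gen S q : alg_gen S (p * q).

Inductive ideal_gen S : {mpoly K[N]} -> Prop :=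
  | ideal_gen_0 : ideal_gen S 0
  | ideal_gen_add a p q of S p & ideal_gen S q : ideal_gen S (a * p + q).

Inductive lin_span S : {mpoly K[N]} -> Prop :=
  | lin_span_0 : lin_span S 0
  | lin_span_add c p q of S p & lin_span S q : lin_span S (c *: p + q).

Definition term_order le : Prop :=
  [/\ antisymmetric le, transitive le, total le,
      forall m, le 0%MM m
    & forall m m1 m2, le m1 m2 -> le (m1 + m)%MM (m2 + m)%MM].

(* The le-largest monomial in the support of p; the initial value 0%MM is
   harmless because it is the least monomial for a term order. *)
Definition init_mnm le (p : {mpoly K[N]}) : 'X_{1..N} :=
  foldr (fun m1 m2 => if le m1 m2 then m2 else m1) 0%MM (msupp p).

Definition init_set le S (q : {mpoly K[N]}) : Prop :=
  exists p, [/\ S p, p != 0 & q = 'X_[init_mnm le p]].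

Definition init_alg le A := alg_gen (init_set le A).

Definition init_ideal le J := ideal_gen (init_set le J).

Definition is_sagbi le C A : Prop :=
  (forall p, C p -> A p) /\
  (forall p, init_alg le A p <-> alg_gen (init_set le C) p).

Definition is_groebner le C J : Prop :=
  (forall p, C p -> J p) /\
  (forall p, init_ideal le J p <-> ideal_gen (init_set le C) p).

(* Koszulness of the K-algebra A = K[S], for a set S of forms of one and the
   same positive degree, standard graded with the elements of S in degree 1
   (so A_1 is the K-span of S, and the graded maximal ideal A_+ consists of the
   elements of A without constant term): the residue field K = A / A_+ has a
   linear free resolution
     ... -> A(-2)^(b 2) -> A(-1)^(b 1) -> A^(b 0) = A -> K -> 0,
   i.e., one whose differentials d i : A^(b i.+1) -> A^(b i), acting on row
   vectors, are given by matrices with entries in A_1. *)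
Definition koszul S : Prop :=
  let A := alg_gen S in
  let overA k (v : 'rV[{mpoly K[N]}]_k) := forall j, A (v 0 j) in
  exists (b : nat -> nat) (d : forall i, 'M[{mpoly K[N]}]_(b i.+1, b i)),
  [/\ b 0%N = 1%N,
      forall i j k, lin_span S (d i j k),
      forall v, overA (b 0%N) v ->
        (forall j, (v 0 j)@_0%MM = 0) <->
        (exists2 w, overA (b 1%N) w & v = w *m d 0%N)
    & forall i v, overA (b i.+1) v ->
        v *m d i = 0 <-> (exists2 w, overA (b i.+2) w & v = w *m d i.+1)].

End PolynomialRing.

Section SparseMatrix.

Variables (K : fieldType) (n r s : nat).

(* Positions of the nonzero entries, rows and columns being numbered from 0. *)
Definition nz_entry (p : 'I_2 * 'I_n) : bool :=
  if p.1 == 0 then (p.2 < r + s)%N else (r <= p.2)%N.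

Definition xvar := {p : 'I_2 * 'I_n | nz_entry p}.

Definition xring := {mpoly K[#|{: xvar}|]}.

Definition sparse_mx : 'M[xring]_(2, n) :=
  \matrix_(i, j) if insub (i, j) is Some v then 'X_(enum_rank (v : xvar)) else 0.

Definition minor2 (i j : 'I_n) : xring :=
  \det (colsub (fun k : 'I_2 => if k == 0 then i else j) sparse_mx).

Definition minors (p : xring) : Prop :=
  exists i j : 'I_n, (i < j)%N /\ p = minor2 i j.

Definition diagonal_order (le : rel 'X_{1..#|{: xvar}|}) : Prop :=
  term_order le /\
  forall i j : 'I_n, (i < j)%N -> minor2 i j != 0 ->
    'X_[init_mnm le (minor2 i j)] = sparse_mx 0 i * sparse_mx 1 j.

(* The special fiber rings of I and of its initial ideal, both of which are
   generated in degree 2, as subalgebras of the polynomial ring. *)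
Definition fiber_I : xring -> Prop := alg_gen minors.

Definition fiber_in_I (le : rel 'X_{1..#|{: xvar}|}) : xring -> Prop :=
  alg_gen (fun q => exists i j : 'I_n,
    [/\ (i < j)%N, minor2 i j != 0 & q = 'X_[init_mnm le (minor2 i j)]]).

Definition yvar :=
  {p : 'I_n * 'I_n | (p.1 < p.2)%N && (minor2 p.1 p.2 != 0)}.

Definition yring := {mpoly K[#|{: yvar}|]}.

Definition y (i j : 'I_n) : yring :=
  if insub (i, j) is Some v then 'X_(enum_rank (v : yvar)) else 0.

Definition phi (p : yring) : xring :=
  p \mPo [tuple minor2 (val (enum_val k)).1 (val (enum_val k)).2
         | k < #|{: yvar}|].

Definition ker_phi (p : yring) : Prop := phi p = 0.

Definition plucker (i j k l : 'I_n) : yring :=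
  y i j * y k l - y i k * y j l + y i l * y j k.

Definition plucker_relations (p : yring) : Prop :=
  exists i j k l : 'I_n, [/\ (i < j)%N, (j < k)%N, (k < l)%N
                           & p = plucker i j k l].

End SparseMatrix.

(* Main.v *)
(* The variables of T are ordered componentwise by their index pairs, and a
   monomial is called standard when its variables form a chain. For a nested
   pair i < j < k < l the Pluecker relation rewrites y_il y_jk into monomials
   whose first factors y_ik, y_ij are below both y_il and y_jk, and which have a
   smaller value of the sum of the squares (j - i)^2; hence the standard
   monomials span F(I). The initial monomial of the image of a standard monomial
   determines it, as the row indices and the column indices of a chain can each
   be sorted. This gives the SAGBI property, and the Groebner basis for a term
   order refining the weight (j - i)^2.
   For Koszulness, the order ideals of variables generate a Koszul filtration:
   if the order ideal O contains everything below v, but not v itself, then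
   (O) : f_v is generated by the f_u with u not above v. Iterated mapping cones
   give a linear resolution whose i-th module is free on the words v_1 ... v_i
   in which no v_(a+1) is above v_a. *)

Require Import Defs.
From mathcomp Require Import all_boot all_order all_algebra.
From mathcomp Require Import mpoly.
From mathcomp Require Import zify ring.
From Stdlib Require Import ClassicalEpsilon.

Set Implicit Arguments.
Unset Strict Implicit.
Unset Printing Implicit Defensive.

Import GRing.Theory.
Local Open Scope ring_scope.

(** * Linear resolutions from filtrations by order ideals *)

Section LinearResolution.

Variables (R : comNzRingType) (P : finType) (leT : rel P).
Hypotheses (leT_refl : reflexive leT) (leT_anti : antisymmetric leT)
  (leT_trans : transitive leT).

Definition down (Om : pred P) := forall u v, leT u v -> Om v -> Om u.
Definition notabove (v : P) : pred P := fun u => ~~ leT v u.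
Definition below (v : P) : pred P := fun u => (u != v) && leT u v.

Fixpoint word k : finType := if k is k'.+1 then (P * word k')%type else unit.

(** Bad words index the bases of the resolution: no letter is followed by one above it. For an order
    ideal [Om], those of positive length starting in [Om] index the resolution of the ideal
    generated by the [f u] with [u] in [Om]. *)
Fixpoint bad (Om : pred P) k : word k -> bool :=
  match k return word k -> bool with
  | 0 => fun=> true
  | k'.+1 => fun w => Om w.1 && @bad (notabove w.1) k' w.2
  end.

Lemma bad_sub (Om Om' : pred P) k (w : word k) :
  (forall u, Om u -> Om' u) -> bad Om w -> bad Om' w.
Proof. by case: k w => //= k w sub /andP[/sub -> ->]. Qed.

Lemma sum_word (V : nmodType) k (F : word k.+1 -> V) :
  \sum_w F w = \sum_u \sum_(w : word k) F (u, w).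
Proof.
by rewrite (pair_bigA _ (fun u (w : word k) => F (u, w))); apply: eq_bigr => -[].
Qed.

Lemma down_notabove v : down (notabove v).
Proof. by move=> u u' uu'; apply: contra => /leT_trans; apply. Qed.

Lemma down_le v : down (fun u => leT u v).
Proof. by move=> u u' uu' /(leT_trans uu'). Qed.

Lemma down_below v : down (below v).
Proof.
move=> u u' uu' /andP[u'v le_u'v]; rewrite /below (leT_trans uu' le_u'v) andbT.
by apply: contra u'v => /eqP uv; apply/eqP/leT_anti; rewrite le_u'v -uv.
Qed.

Lemma below_down (Om : pred P) v u : down Om -> Om v -> below v u -> Om u.
Proof. by move=> dOm Omv /andP[_ /dOm]; apply. Qed.

Variables (f : P -> R) (A A1 : R -> Prop).
Hypotheses (A_0 : A 0) (A_B : forall a b, A a -> A b -> A (a - b))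
  (A_M : forall a b, A a -> A b -> A (a * b)).
Hypotheses (A1_0 : A1 0) (A1_B : forall a b, A1 a -> A1 b -> A1 (a - b))
  (A1_A : forall a, A1 a -> A a).

Lemma A_D a b : A a -> A b -> A (a + b).
Proof. by move=> Aa Ab; rewrite -[b]opprK -[- b]sub0r; do 2!apply: A_B => //. Qed.

Lemma A_sum (I : finType) (F : I -> R) : (forall i, A (F i)) -> A (\sum_i F i).
Proof. by move=> AF; apply: big_ind => //; apply: A_D. Qed.

(** An element of the free [A]-module on the bad words, kept as a function on all words so that the
    type does not depend on [Om]. *)
Definition chains Om k (x : word k -> R) :=
  forall w, A (x w) /\ (~~ bad Om w -> x w = 0).

Definition bd k l (x : word k -> R) (D : word k -> word l -> R) (w' : word l) :=
  \sum_w x w * D w w'.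

Definition linear_on k (D : word k.+1 -> word k -> R) :=
  forall w w', bad predT w -> A1 (D w w').

(** Every order ideal spans a subcomplex. *)
Definition supported k (D : word k.+1 -> word k -> R) :=
  forall Om, down Om -> forall w w', bad Om w -> ~~ bad Om w' -> D w w' = 0.

(** The mapping cone structure: on words starting with [v], modulo other first letters, the
    differential is the previous one. *)
Definition triangular k (D : word k.+1 -> word k -> R)
    (D' : word k.+2 -> word k.+1 -> R) :=
  forall v (w : word k.+1) (w' : word k),
    bad (notabove v) w -> D' (v, w) (v, w') = D w w'.

Definition is_complex k (D : word k.+1 -> word k -> R)
    (D' : word k.+2 -> word k.+1 -> R) :=
  forall w, bad predT w -> forall w'', bd (D' w) D w'' = 0.

(** Exactness is asked for all order ideals at once: the next differential uses it for the letters
    below [v] and for those not above [v]. *)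
Definition is_exact k (D : word k.+1 -> word k -> R)
    (D' : word k.+2 -> word k.+1 -> R) :=
  forall Om, down Om -> forall x, chains Om x -> (forall w', bd x D w' = 0) ->
    exists2 y, chains Om y & forall w, bd y D' w = x w.

(* The component of a chain on the words with first letter v is pushed into
   the image one letter v at a time, a maximal one first. *)
Lemma exact_triangular k (D : word k.+1 -> word k -> R)
    (D' : word k.+2 -> word k.+1 -> R) :
  linear_on D' -> supported D' -> triangular D D' -> is_complex D D' ->
  (forall Om v x, down Om -> Om v -> (forall u, Om u -> leT v u -> u = v) ->
     chains Om x -> (forall w', bd x D w' = 0) ->
     exists2 y, chains (notabove v) y & forall w : word k, bd y D w = x (v, w)) ->
  is_exact D D'.
Proof.
move=> linD' suppD' triD' cplx peel Om.
have [n] := ubnP #|Om|; elim: n => // n IHn in Om * => leOm dOm x Mx xD.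
have [Om0 | /existsP[u0 Omu0]] := boolP [forall u, ~~ Om u].
  exists (fun=> 0); first by [].
  move=> w; rewrite /bd big1 => [|w' _]; last by rewrite mul0r.
  by case: (Mx w) => _ -> //; case: w => u w; rewrite negb_and (forallP Om0).
rewrite negbK in Omu0.
have [v Omv maxv]: exists2 v, Om v & forall u, Om u -> leT v u -> u = v.
  (* A letter with the fewest letters of [Om] above it is maximal. *)
  pose up v := #|[pred u | Om u && leT v u]|.
  case: (@arg_minnP _ u0 Om up Omu0) => v Omv minv; exists v => // u Omu vu.
  have sub : [pred t | Om t && leT u t] \subset [pred t | Om t && leT v t].
    by apply/subsetP => t; rewrite !inE => /andP[-> /(leT_trans vu)->].
  have /subset_cardP-/(_ sub)/(_ v) : up u = up v.
    by apply/eqP; rewrite eqn_leq (subset_leq_card sub) minv.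
  by rewrite !inE Omv leT_refl => /= uv; apply: leT_anti; rewrite uv.
have [y My yD] := peel _ _ _ dOm Omv maxv Mx xD.
(* [ey] is [y] with [v] put in front of each word. Subtracting its boundary from [x] clears the
   component at [v], which leaves a cycle on [Om] without [v]. *)
pose ey (w : word k.+2) := if w.1 == v then y w.2 else 0.
have Mey : chains Om ey.
  move=> [u w]; rewrite /ey /=; have [-> | //] := eqVneq u v.
  by rewrite Omv /=; apply: My.
have ey_bad w : ~~ bad predT w -> ey w = 0.
  by move=> nbw; case: (Mey w) => _ -> //; apply: contra nbw; apply: bad_sub.
have eyE (w' : word k.+1) : bd ey D' w' = \sum_w y w * D' (v, w) w'.
  rewrite /bd sum_word.
  rewrite (bigD1 v) //= [X in _ + X]big1 ?addr0 => [|u uv].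
    by apply: eq_bigr => w _; rewrite /ey eqxx.
  by rewrite big1 // => w _; rewrite /ey (negPf uv) mul0r.
have AeyD' w' : A (bd ey D' w').
  apply: A_sum => w; have [bw | /ey_bad ->] := boolP (bad predT w).
    by apply: A_M; [case: (Mey w) | apply/A1_A/linD'].
  by rewrite mul0r.
pose x' w := x w - bd ey D' w.
pose Om' : pred P := fun u => (u != v) && Om u.
have dOm' : down Om'.
  move=> u u' uu' /andP[u'v Omu']; rewrite /Om' (dOm _ _ uu' Omu') andbT.
  by apply: contra u'v => /eqP uv; apply/eqP/maxv => //; rewrite -uv.
have Mx' : chains Om' x'.
  move=> w; split; first by apply: A_B => //; case: (Mx w).
  case: w => u w; rewrite /= /Om' /x' eyE -andbA => nb.
  have [uv | uv] := eqVneq u v.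
    rewrite uv -yD; apply/eqP; rewrite subr_eq0; apply/eqP.
    apply: eq_bigr => t _; have [bt | /(proj2 (My t)) ->] := boolP (bad (notabove v) t).
      by rewrite triD'.
    by rewrite !mul0r.
  rewrite uv /= in nb.
  case: (Mx (u, w)) => _ -> //; rewrite sub0r big1 ?oppr0 // => t _.
  have [bt | /(proj2 (My t)) ->] := boolP (bad (notabove v) t); last by rewrite mul0r.
  by rewrite (suppD' _ dOm) ?mulr0 //= Omv.
have x'D w' : bd x' D w' = 0.
  rewrite /bd /x'; under eq_bigr do rewrite mulrBl.
  rewrite sumrB -/(bd x D w') xD sub0r.
  under eq_bigr do rewrite mulr_suml.
  rewrite exchange_big /= big1 ?oppr0 // => w _.
  have [bw | /ey_bad ->] := boolP (bad predT (w : word k.+2)); last first.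
    by rewrite big1 // => t _; rewrite !mul0r.
  under eq_bigr do rewrite -mulrA.
  by rewrite -mulr_sumr; have := cplx _ bw w'; rewrite /bd => ->; rewrite mulr0.
have [|y' My' y'D'] := IHn Om' _ dOm' _ Mx' x'D.
  rewrite -ltnS; apply: leq_trans leOm; rewrite ltnS; apply: proper_card.
  apply/properP; split; first by apply/subsetP => u; rewrite !unfold_in => /andP[].
  by exists v; rewrite // unfold_in /Om' eqxx.
exists (fun w => ey w + y' w) => [w | w].
  have [[Ae Ze] [Ay Zy]] := (Mey w, My' w); split; first exact: A_D.
  move=> nb; rewrite Ze // Zy ?addr0 //; apply: contra nb; apply: bad_sub.
  by move=> u /andP[].
rewrite /bd; under eq_bigr do rewrite mulrDl.
by rewrite big_split /= [X in _ + X]y'D' /x' addrC subrK.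
Qed.

(* Extraction of the linear and quadratic parts of the elements of A. *)
Variables (pr1 pr2 : {additive R -> R}).
Hypotheses (pr1_A1 : forall a, A a -> A1 (pr1 a))
  (pr1_id : forall a, A1 a -> pr1 a = a)
  (pr2M : forall a l, A a -> A1 l -> pr2 (a * l) = pr1 a * l).

Record good k (D : word k.+1 -> word k -> R)
    (D' : word k.+2 -> word k.+1 -> R) : Prop := Good {
  good_lin : linear_on D; good_lin' : linear_on D';
  good_supp : supported D; good_supp' : supported D';
  good_tri : triangular D D'; good_cplx : is_complex D D';
  good_exact : is_exact D D' }.

(* D'' maps the word v w to v D'(w), corrected by a chain on words starting below
   v that is obtained from exactness one degree lower. *)
Lemma good_step k (D : word k.+1 -> word k -> R)
    (D' : word k.+2 -> word k.+1 -> R) :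
  good D D' -> exists D'', good D' D''.
Proof.
case=> linD linD' supD supD' triD cplx ex.
pose q v (w : word k.+2) t := \sum_(w' : word k.+1) D' w w' * D' (v, w') t.
have bad_pre v k' (w : word k') : bad (notabove v) w -> bad predT w.
  exact: bad_sub.
have zP (v : P) w : exists z : word k.+2 -> R, bad (notabove v) w ->
    [/\ forall t, A1 (z t), forall t, ~~ bad (below v) t -> z t = 0
      & forall t, bd z D' t = q v w t].
  have [bw | nbw] := boolP (bad (notabove v) w); last by exists (fun=> 0).
  have dna := down_notabove (v := v).
  have D'0 w' : ~~ bad (notabove v) w' -> D' w w' = 0 by move=> ?;
    rewrite (supD' _ dna).
  have A1q w' t : D' w w' = 0 \/ A1 (D' (v, w') t).
    have [bw' | /D'0 ->] := boolP (bad (notabove v) (w' : word k.+1));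
      [right | by left].
    exact: linD'.
  have AD' w' : A1 (D' w w') by apply: linD'; apply: bad_pre bw.
  (* Words in [q v w] start at or below [v] because [D'] is supported; the component at [v] itself
     is, by triangularity, the boundary of the boundary of [w], hence zero. *)
  have Mq : chains (below v) (q v w).
    move=> [u t]; split.
      apply: A_sum => w'; case: (A1q w' (u, t)) => [-> | ?]; first by rewrite mul0r.
      by apply: A_M; apply: A1_A.
    move=> nb; have [uv | uv] := eqVneq u v.
      rewrite {}uv /q -[RHS](cplx w (bad_pre _ _ _ bw) t) /bd.
      apply: eq_bigr => w' _.
      have [bw' | /D'0 ->] := boolP (bad (notabove v) (w' : word k.+1));
        last by rewrite !mul0r.
      by rewrite triD.
    apply: big1 => w' _.
    have [bw' | /D'0 ->] := boolP (bad (notabove v) (w' : word k.+1));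
      last by rewrite mul0r.
    rewrite (supD' _ (down_le (v := v)) (v, w')) ?mulr0 //= ?leT_refl //.
    by move: nb; rewrite /= /below uv.
  have qD t : bd (q v w) D t = 0.
    rewrite /bd /q; under eq_bigr do rewrite mulr_suml.
    rewrite exchange_big /= big1 // => w' _.
    have [bw' | /D'0 ->] := boolP (bad (notabove v) (w' : word k.+1)); last first.
      by rewrite big1 // => ? _; rewrite !mul0r.
    under eq_bigr do rewrite -mulrA.
    by rewrite -mulr_sumr; have := cplx (v, w') bw' t; rewrite /bd => ->; rewrite mulr0.
  have [z Mz zD] := ex _ (down_below (v := v)) _ Mq qD.
  (* Exactness says nothing about degrees, so only the linear part of [z] is kept. Its boundary is
     still [q v w], because [q v w] is quadratic and [D'] is linear. *)
  exists (pr1 \o z) => _; split => [t | t nb | t] /=.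
  - by apply: pr1_A1; case: (Mz t).
  - by case: (Mz t) => _ ->; rewrite ?raddf0.
  have pr2q : pr2 (q v w t) = q v w t.
    rewrite raddf_sum; apply: eq_bigr => w' _.
    case: (A1q w' t) => [-> | ?]; first by rewrite mul0r raddf0.
    by rewrite pr2M ?pr1_id //; apply: A1_A.
  rewrite -pr2q -zD raddf_sum; apply: eq_bigr => w' _ /=.
  have [Az z0] := Mz w'.
  have [bw' | /z0 ->] := boolP (bad (below v) (w' : word k.+2));
    last by rewrite mul0r !raddf0 mul0r.
  by rewrite pr2M //; apply: linD'; apply: bad_sub bw'.
pose Z v w := projT1 (constructive_indefinite_description _ (zP v w)).
have ZP v w (bw : bad (notabove v) w) :
    [/\ forall t, A1 (Z v w t), forall t, ~~ bad (below v) t -> Z v w t = 0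
      & forall t, bd (Z v w) D' t = q v w t].
  exact: (projT2 (constructive_indefinite_description _ (zP v w))).
pose D'' (w : word k.+3) (t : word k.+2) :=
  (if t.1 == w.1 then D' w.2 t.2 else 0) - Z w.1 w.2 t.
have lin : linear_on D''.
  move=> [v w] [u t] /= bw; apply: A1_B; last by case: (ZP _ _ bw).
  by case: eqP => //= _; exact: linD' (bad_pre v k.+2 w bw).
have sup : supported D''.
  move=> Om dOm [v w] [u t] /= /andP[Omv bw] nb; rewrite /D'' /=.
  have [_ Z0 _] := ZP _ _ bw; rewrite [Z _ _ _]Z0 ?subr0 => [|/=].
    have [uv | //] := eqVneq u v; rewrite uv Omv /= in nb.
    by rewrite (supD' _ (down_notabove (v := v))).
  by apply: contra nb => /andP[/(below_down dOm Omv)-> ->].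
have tri : triangular D' D''.
  move=> v w t bw; rewrite /D'' /= eqxx; case: (ZP _ _ bw) => _ -> /=.
    by rewrite subr0.
  by rewrite /below eqxx.
have cpl : is_complex D' D''.
  move=> [v w] /= bw t; rewrite /bd /D''.
  under eq_bigr do rewrite mulrBl.
  rewrite sumrB; have [_ _ /(_ t) ZD] := ZP _ _ bw; rewrite [X in _ - X]ZD.
  apply/eqP; rewrite subr_eq0; apply/eqP.
  rewrite sum_word /=.
  rewrite (bigD1 v) //= [X in _ + X]big1 ?addr0 => [|u uv].
    by apply: eq_bigr => w' _; rewrite eqxx.
  by rewrite big1 // => w' _; rewrite (negPf uv) mul0r.
exists D''; split=> //; apply: exact_triangular => //.
(* As [v] is maximal in [Om], words with another first letter have no boundary on words starting
   with [v]. Hence the component of [x] at [v] is a cycle one degree lower. *)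
move=> Om v x dOm Omv maxv Mx xD'.
have Mxv : chains (notabove v) (fun w : word k.+1 => x (v, w)).
  by move=> w; case: (Mx (v, w)) => Ax x0; split => // nb; apply: x0; rewrite /= Omv.
apply: ex Mxv _ => [|t]; first exact: down_notabove.
rewrite -[RHS](xD' (v, t)) /bd [RHS]sum_word.
rewrite [RHS](bigD1 v) //= [X in _ + X]big1 ?addr0 => [|u uv].
  apply: eq_bigr => w _; have [bw | nbw] := boolP (bad (notabove v) (w : word k.+1)).
    by rewrite triD.
  by rewrite (proj2 (Mx (v, w))) ?mul0r //= Omv.
rewrite big1 // => w _; have [bw | nbw] := boolP (bad Om ((u, w) : word k.+2));
  last first.
  by rewrite (proj2 (Mx (u, w))) ?mul0r.
have [vu | nvu] := boolP (leT v u).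
  by case/negP: uv; apply/eqP/maxv => //; case/andP: bw.
rewrite (supD' _ (down_le (v := u))) ?mulr0 //=; last by rewrite (negPf nvu).
by rewrite leT_refl; case/andP: bw.
Qed.

(** * Conditions on the generators and the start of the resolution *)

Hypothesis f_A1 : forall v, A1 (f v).
Hypothesis straight : forall v u, ~~ leT v u ->
  exists l : P -> R, [/\ forall t, A1 (l t), forall t, ~~ below v t -> l t = 0
                      & \sum_t l t * f t = f v * f u].
(** That is, [f v] is a nonzerodivisor of [A] modulo the ideal generated by the [f u] with [u] not
    above [v]. *)
Hypothesis colon : forall v a (c : P -> R), A a -> (forall u, A (c u)) ->
  a * f v = \sum_(u | ~~ leT v u) c u * f u ->
  exists2 c' : P -> R, forall u, A (c' u)
    & a = \sum_(u | ~~ leT v u) c' u * f u.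

Definition bd0 (w : word 1) (_ : word 0) := f w.1.

Lemma sum_word0 (V : nmodType) (F : word 0 -> V) : \sum_w F w = F tt.
Proof. by rewrite (bigD1 tt) //= big1 ?addr0 // => -[]. Qed.

(** The word [v u] goes to [f u] at [v] minus the straightened form of [f v * f u], so applying
    [bd0] gives zero. For exactness, the letters of [Om] other than a maximal [v] are not above [v],
    and [colon] treats the coefficient at [v]. *)
Lemma good_start : exists D, good bd0 D.
Proof.
have lP (vu : P * P) : exists l : P -> R, ~~ leT vu.1 vu.2 ->
    [/\ forall t, A1 (l t), forall t, ~~ below vu.1 t -> l t = 0
      & \sum_t l t * f t = f vu.1 * f vu.2].
  case: (boolP (leT vu.1 vu.2)) => [_ | /straight[l lE]]; last by exists l.
  by exists (fun=> 0).
have [l lE] := choice _ lP.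
have {}lE v (t : word 1) : bad (notabove v) t ->
    [/\ forall u, A1 (l (v, t.1) u), forall u, ~~ below v u -> l (v, t.1) u = 0
      & \sum_u l (v, t.1) u * f u = f v * f t.1].
  by case/andP=> vt _; apply: lE.
pose D (w : word 2) (t : word 1) :=
  (if t.1 == w.1 then f w.2.1 else 0) - l (w.1, w.2.1) t.1.
have lin0 : linear_on bd0 by move=> w t _; apply: f_A1.
have sup0 : supported bd0 by [].
have lin : linear_on D.
  move=> [v w] t /= bw; apply: A1_B; first by case: eqP.
  by have [? _ _] := lE v w bw.
have sup : supported D.
  move=> Om dOm [v w] [u []] /andP[Omv bw]; rewrite [bad _ _]/= andbT => nb.
  have [_ l0 _] := lE _ _ bw.
  rewrite /D /= l0 ?subr0; last by apply: contra nb; apply: below_down.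
  by case: eqP => // uv; rewrite uv Omv in nb.
have tri : triangular bd0 D.
  move=> v w [] bw; have [_ l0 _] := lE _ _ bw.
  by rewrite /D /= eqxx l0 ?subr0 // /below eqxx.
have cpl : is_complex bd0 D.
  move=> [v w] /= bw t; have [_ _ lD] := lE v w bw.
  rewrite /bd sum_word; under eq_bigr do rewrite sum_word0 mulrBl.
  rewrite sumrB [X in _ - X]lD (bigD1 v) //= eqxx big1 ?addr0.
    by rewrite mulrC subrr.
  by move=> u /negPf uv; rewrite /= uv mul0r.
exists D; split=> //; apply: exact_triangular => //.
move=> Om v x dOm Omv maxv Mx xD.
have [|||c Ac xv] := colon (c := fun u => - x (u, tt)) (v := v) (a := x (v, tt)).
- by case: (Mx (v, tt)).
- by move=> u; rewrite -sub0r; apply: A_B => //; case: (Mx (u, tt)).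
- apply/eqP; rewrite -subr_eq0 -[X in _ == X](xD tt) /bd sum_word.
  under [X in _ == X]eq_bigr do rewrite sum_word0.
  rewrite [X in _ == X](bigD1 v) //= -sumrN; apply/eqP; congr (_ + _).
  rewrite big_mkcond [RHS]big_mkcond; apply: eq_bigr => u _ /=.
  have [-> | uv] := eqVneq u v; first by rewrite leT_refl.
  rewrite mulNr opprK; case: ifPn => // /negbNE vu.
  rewrite (proj2 (Mx (u, tt))) ?mul0r //= andbT; apply: contra uv => Omu.
  by apply/eqP/maxv.
exists (fun w : word 1 => if leT v w.1 then 0 else c w.1) => [[u []] | []].
  by rewrite /notabove /=; case: leT.
rewrite xv /bd sum_word [RHS]big_mkcond; apply: eq_bigr => u _.
by rewrite sum_word0 /=; case: leT; rewrite ?mul0r.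
Qed.

(** The recursion carries two consecutive differentials together with the proof that they are
    [good], since each step consumes both. *)
Lemma good_sequence : exists D : forall k, word k.+1 -> word k -> R,
  D 0%N = bd0 /\ forall k, good (D k) (D k.+1).
Proof.
have [D1 good1] := good_start.
pose state k := {DD : (word k.+1 -> word k -> R) * (word k.+2 -> word k.+1 -> R)
                | good DD.1 DD.2}.
pose next k (s : state k) : state k.+1 :=
  let: D'' := constructive_indefinite_description _ (good_step (svalP s)) in
  exist _ ((sval s).2, sval D'') (svalP D'').
pose st := fix st k : state k :=
  if k is k'.+1 then next k' (st k') else exist _ (bd0, D1) good1.
exists (fun k => (sval (st k)).1); split=> // k.
exact: svalP (st k).
Qed.

(** * From functions on words to row vectors and matrices *)

Definition badword k := {w : word k | bad predT w}.
Definition nbad k := #|{: badword k}|.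

Definition chain_of k (v : 'rV[R]_(nbad k)) (w : word k) :=
  if insub w is Some s then v 0 (enum_rank (s : badword k)) else 0.

Definition row_of k (x : word k -> R) : 'rV[R]_(nbad k) :=
  \row_j x (val (enum_val j)).

Definition mx_of k (D : word k.+1 -> word k -> R) : 'M[R]_(nbad k.+1, nbad k) :=
  \matrix_(i, j) D (val (enum_val i)) (val (enum_val j)).

Lemma chain_ofK k (v : 'rV[R]_(nbad k)) : row_of (chain_of v) = v.
Proof. by apply/rowP => j; rewrite mxE /chain_of valK enum_valK. Qed.

Lemma chains_chain_of k (v : 'rV[R]_(nbad k)) :
  (forall j, A (v 0 j)) -> chains predT (chain_of v).
Proof.
by move=> Av w; rewrite /chain_of; case: insubP => [s -> _|_]; split.
Qed.

Lemma sum_nbad (V : nmodType) k (F : word k -> V) :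
  (forall w, ~~ bad predT w -> F w = 0) ->
  \sum_w F w = \sum_(j < nbad k) F (val (enum_val j)).
Proof.
move=> F0; rewrite (bigID (bad predT (k:=k))) /= [X in _ + X]big1 ?addr0 //.
pose rk (w : word k) : option 'I_(nbad k) :=
  omap enum_rank (insub w : option (badword k)).
rewrite (reindex_omap (fun j : 'I_(nbad k) => val (enum_val j)) rk) => [|w bw].
  by apply: eq_bigl => j; rewrite valP /rk valK /= enum_valK eqxx.
by rewrite /rk insubT /= enum_rankK.
Qed.

Lemma row_of_bd k (D : word k.+1 -> word k -> R) x :
  chains predT x -> row_of (bd x D) = row_of x *m mx_of D.
Proof.
move=> Mx; apply/rowP => j; rewrite !mxE /bd.
rewrite sum_nbad => [|w nb]; last by rewrite (proj2 (Mx w)) ?mul0r.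
by apply: eq_bigr => i _; rewrite !mxE.
Qed.

Lemma mx_of_complex k D D' : good (k:=k) D D' -> mx_of D' *m mx_of D = 0.
Proof.
case=> _ _ _ supD' _ cplx _; apply/matrixP => i j.
rewrite !mxE -[RHS](cplx _ (valP (enum_val i)) (val (enum_val j))) /bd.
rewrite [RHS]sum_nbad => [|w nb]; first by apply: eq_bigr => t _; rewrite !mxE.
by rewrite (supD' predT) ?mul0r //; apply: valP.
Qed.

Theorem linear_resolution (eps : R -> Prop) :
  (forall a, A a -> eps a <->
     exists2 c : P -> R, forall u, A (c u) & a = \sum_u c u * f u) ->
  exists (b : nat -> nat) (d : forall i, 'M[R]_(b i.+1, b i)),
  [/\ b 0%N = 1%N, forall i j k, A1 (d i j k),
      forall v : 'rV_(b 0%N), (forall j, A (v 0 j)) ->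
        (forall j, eps (v 0 j)) <->
        exists2 w : 'rV_(b 1%N), forall j, A (w 0 j) & v = w *m d 0%N
    & forall i (v : 'rV_(b i.+1)), (forall j, A (v 0 j)) ->
        v *m d i = 0 <->
        exists2 w : 'rV_(b i.+2), forall j, A (w 0 j) & v = w *m d i.+1].
Proof.
move=> epsP; have [D [D0 goodD]] := good_sequence.
exists nbad, (fun k => mx_of (D k)).
have linD k : linear_on (D k) by case: (goodD k).
have supD k : supported (D k) by case: (goodD k).
have b0 : nbad 0 = 1%N.
  by rewrite /nbad card_sig; apply/eqP/fintype1P; exists tt => -[].
split=> // [i j k | v Av | i v Av].
- by rewrite mxE; apply: linD; apply: valP.
- have j0E (j : 'I_(nbad 0)) : val (enum_val j) = tt by case: (val _).
  have j0 : 'I_(nbad 0) by rewrite b0; exact: ord0.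
  have epsv j := epsP _ (Av j).
  have bdE y : bd y (D 0%N) tt = \sum_u y (u, tt) * f u.
    by rewrite D0 /bd sum_word; under eq_bigr do rewrite sum_word0.
  split=> [/(_ j0)/epsv[c Ac vc] | [w Aw ->] j].
    have Mc : chains predT (fun w : word 1 => c w.1) by move=> [u []].
    exists (row_of (fun w : word 1 => c w.1)) => [j|]; first by rewrite mxE.
    rewrite -row_of_bd //; apply/rowP => j; rewrite !mxE j0E bdE -vc.
    by congr (v 0 _); apply/enum_val_inj/val_inj; rewrite !j0E.
  have Mw := chains_chain_of Aw.
  rewrite -[w]chain_ofK -row_of_bd // mxE j0E bdE; apply/epsP.
    by apply: A_sum => u; apply: A_M; [case: (Mw (u, tt)) | apply: A1_A].
  by exists (fun u => chain_of w (u, tt)) => // u; case: (Mw (u, tt)).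
have Mv := chains_chain_of Av.
split=> [vD | [w Aw ->]].
  have dT : down predT by [].
  have [|y My yD] := good_exact (goodD i) dT Mv.
    (* The matrix equation only speaks of bad words; at all others the boundary vanishes by
       support. *)
    move=> t; have [bt | nbt] := boolP (bad predT t); last first.
      rewrite /bd big1 // => w _; have [bw | /(proj2 (Mv w))->] := boolP (bad predT w).
        by rewrite (supD i predT) ?mulr0.
      by rewrite mul0r.
    have := congr1 (fun r : 'rV_(nbad i) => chain_of r t) vD.
    rewrite -{1}[v]chain_ofK -row_of_bd // /chain_of.
    by case: insubP => [s _ <-|/negP//]; rewrite !mxE enum_rankK.
  exists (row_of y) => [j|]; first by rewrite mxE; case: (My (val (enum_val j))).
  by rewrite -row_of_bd // -[LHS]chain_ofK; apply/rowP => j; rewrite !mxE yD.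
have Mw := chains_chain_of Aw.
by rewrite -mulmxA mx_of_complex ?mulmx0.
Qed.

End LinearResolution.

(** * Term orders *)

Section TermOrder.

Variables (K : fieldType) (N : nat) (le : rel 'X_{1..N}).
Hypothesis le_term : term_order le.
Implicit Types (p q : {mpoly K[N]}) (m : 'X_{1..N}).

Lemma term_anti : antisymmetric le. Proof. by case: le_term. Qed.
Lemma term_trans : transitive le. Proof. by case: le_term. Qed.
Lemma term_total : total le. Proof. by case: le_term. Qed.
Lemma term_le0 m : le 0%MM m. Proof. by case: le_term. Qed.
Lemma term_refl : reflexive le. Proof. by move=> m; have :=
  term_total m m; rewrite orbb. Qed.
Lemma term_addr m m1 m2 : le m1 m2 -> le (m1 + m)%MM (m2 + m)%MM.
Proof. by case: le_term => _ _ _ _; apply. Qed.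
Lemma term_addl m m1 m2 : le m1 m2 -> le (m + m1)%MM (m + m2)%MM.
Proof. by rewrite ![(m + _)%MM]addmC; apply: term_addr. Qed.

Lemma exists_le_max (T : eqType) (h : T -> 'X_{1..N}) (s : seq T) :
  s != [::] -> exists2 x, x \in s & forall y, y \in s -> le (h y) (h x).
Proof.
elim: s => // x s IHs _; have [-> | /IHs[y ys maxy]] := eqVneq s [::].
  by exists x; rewrite ?mem_head // => y; rewrite inE => /eqP->; apply: term_refl.
have [le_xy | le_yx] := orP (term_total (h x) (h y)).
  by exists y; [rewrite inE ys orbT | move=> z /predU1P[->|/maxy]].
exists x => [|z /predU1P[->|/maxy le_zy]]; [exact: mem_head | exact: term_refl |].
exact: term_trans le_zy le_yx.
Qed.

Definition leading p m := p@_m != 0 /\ forall m', p@_m' != 0 -> le m' m.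

Lemma leading_inj p m m' : leading p m -> leading p m' -> m = m'.
Proof. by move=> [pm maxm] [pm' maxm']; apply: term_anti; rewrite maxm' ?maxm. Qed.

Lemma init_mnm_leading p : p != 0 -> leading p (init_mnm le p).
Proof.
rewrite -msupp_eq0 /init_mnm => p0.
suff [mem max] : init_mnm le p \in msupp p /\
    forall m, m \in msupp p -> le m (init_mnm le p).
  by split=> [|m]; rewrite -mcoeff_msupp //; apply: max.
rewrite /init_mnm; elim: (msupp p) p0 => // m s IHs _ /=.
have [-> /= | /IHs[mem max]] := eqVneq s [::].
  have le_m x : x \in [:: m] -> le x m by rewrite inE => /eqP->; apply: term_refl.
  (* The initial value [0] of the fold can win against [m] only if it equals [m]. *)
  case: ifP => [le_m0 | _]; last by rewrite mem_head.
  have -> : 0%MM = m by apply: term_anti; rewrite term_le0 le_m0.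
  by rewrite mem_head.
set m0 := foldr _ _ _ in mem max *.
case: ifP => le_m; split; rewrite ?inE ?mem ?eqxx ?orbT // => x /predU1P[-> // | xs].
- exact: max.
- exact: term_refl.
apply: term_trans (max _ xs) _.
by have := term_total m m0; rewrite le_m.
Qed.

Lemma leading_neq0 p m : leading p m -> p != 0.
Proof. by case=> pm _; apply: contraNneq pm => ->; rewrite mcoeff0. Qed.

Lemma leading_init p m : leading p m -> init_mnm le p = m.
Proof.
by move=> lpm; apply: (leading_inj _ lpm); apply/init_mnm_leading/leading_neq0/lpm.
Qed.

Lemma leadingX m : leading 'X_[m] m.
Proof.
split=> [|m']; rewrite mcoeffX ?eqxx ?oner_neq0 //.
by case: (m =P m') => [-> _|_]; [apply: term_refl | rewrite eqxx].
Qed.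

Lemma leadingM p q m m' :
  leading p m -> leading q m' -> leading (p * q) (m + m').
Proof.
move=> [pm maxm] [qm' maxm'].
have supp (p' : {mpoly K[N]}) t : (forall k, p'@_k != 0 -> p@_k != 0) ->
    (p' * q)@_t != 0 -> exists k k', [/\ p'@_k != 0, le k m, le k' m'
      & t = (k + k')%MM].
  move=> sub; rewrite -mcoeff_msupp => /msuppM_le/allpairsP[[k k'] /=].
  rewrite !mcoeff_msupp => -[p'k qk' ->]; exists k, k'.
  by split=> //; [apply/maxm/sub | apply: maxm'].
split; last first.
  move=> t /supp[] // k [k' [_ le_k le_k' ->]].
  exact: term_trans (term_addr _ le_k) (term_addl _ le_k').
(* The leading term of [p] is split off. In the rest, [k + k' = m + m'] with [k] at most [m] and
   [k'] at most [m'] forces [k' = m'], hence [k = m], which no longer occurs. *)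
pose p' := p - p@_m *: 'X_[m].
have p'k k : p'@_k = if k == m then 0 else p@_k.
  rewrite mcoeffB mcoeffZ mcoeffX eq_sym; case: eqP => [->|_].
    by rewrite mulr1 subrr.
  by rewrite mulr0 subr0.
have -> : p * q = p@_m *: (q * 'X_[m]) + p' * q.
  by rewrite /p' mulrBl -scalerAl [q * _]mulrC addrC subrK.
rewrite mcoeffD mcoeffZ mcoeffMX.
suff -> : (p' * q)@_(m + m') = 0 by rewrite addr0 mulf_neq0.
apply/eqP/contraT => /supp[k | k [k' [p'k0 le_k le_k' kk']]].
  by rewrite p'k; case: ifP => // _; rewrite eqxx.
have k'm' : k' = m'.
  apply: (@addmI _ m); apply: term_anti; rewrite term_addl //=.
  by rewrite kk'; apply: term_addr.
move: kk'; rewrite k'm' => /addIm km.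
by rewrite p'k -km !eqxx in p'k0.
Qed.

Lemma leadingXn p m i : leading p m -> leading (p ^+ i) (m *+ i).
Proof.
move=> lpm; elim: i => [|i IHi]; last by rewrite exprS mulmS; apply: leadingM.
by rewrite expr0 -mpolyX0; apply: leadingX.
Qed.

Lemma leading_prod (I : finType) (F : I -> {mpoly K[N]}) (h : I -> 'X_{1..N}) :
  (forall i, leading (F i) (h i)) -> leading (\prod_i F i) (\sum_i h i)%MM.
Proof.
move=> lF; apply: (big_rec2 leading) => [|i m p _]; last exact: leadingM.
by rewrite -mpolyX0; apply: leadingX.
Qed.

End TermOrder.

(** * Algebras with a straightening law *)

Lemma alg_gen_sub (K : fieldType) N (S S' : {mpoly K[N]} -> Prop) :
  (forall p, S p -> alg_gen S' p) -> forall p, alg_gen S p -> alg_gen S' p.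
Proof.
move=> sub p; elim=> [q /sub // | c | q q' _ IH _ IH' | q q' _ IH _ IH'].
- exact: alg_gen_cst.
- exact: alg_gen_add.
- exact: alg_gen_mul.
Qed.

(** * Closure properties of subalgebras and linear spans *)

Section AlgGen.

Variables (K : fieldType) (N : nat) (S : {mpoly K[N]} -> Prop).

Lemma alg_gen_0 : alg_gen S 0.
Proof. by have := alg_gen_cst S 0; rewrite mpolyC0. Qed.

Lemma alg_gen_1 : alg_gen S 1.
Proof. by have := alg_gen_cst S 1; rewrite mpolyC1. Qed.

Lemma alg_gen_scale c p : alg_gen S p -> alg_gen S (c *: p).
Proof. by rewrite -mul_mpolyC => Sp; apply: alg_gen_mul => //; apply: alg_gen_cst. Qed.

Lemma alg_gen_sub2 p q : alg_gen S p -> alg_gen S q -> alg_gen S (p - q).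
Proof. by move=> Sp Sq; rewrite -scaleN1r; apply/alg_gen_add/alg_gen_scale. Qed.

Lemma alg_gen_exp p i : alg_gen S p -> alg_gen S (p ^+ i).
Proof.
move=> Sp; elim: i => [|i IHi]; first by rewrite expr0; apply: alg_gen_1.
by rewrite exprS; apply: alg_gen_mul.
Qed.

Lemma alg_gen_prod (I : finType) (F : I -> {mpoly K[N]}) :
  (forall i, alg_gen S (F i)) -> alg_gen S (\prod_i F i).
Proof. by move=> SF; apply: big_ind => //; [apply: alg_gen_1 | apply: alg_gen_mul]. Qed.

Lemma alg_gen_sum (I : Type) (sq : seq I) (F : I -> {mpoly K[N]}) :
  (forall i, alg_gen S (F i)) -> alg_gen S (\sum_(i <- sq) F i).
Proof. by move=> SF; apply: big_ind => //; [apply: alg_gen_0 | apply: alg_gen_add]. Qed.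

Lemma lin_span_in p : S p -> lin_span S p.
Proof. by move=> Sp; rewrite -[p]scale1r -[_ *: _]addr0;
  apply: lin_span_add Sp (lin_span_0 _). Qed.

Lemma lin_span_D p q : lin_span S p -> lin_span S q -> lin_span S (p + q).
Proof.
by elim=> [|c p1 p2 Sp1 _ IH] Sq; rewrite ?add0r // -addrA; apply/lin_span_add/IH.
Qed.

Lemma lin_span_scale c p : lin_span S p -> lin_span S (c *: p).
Proof.
elim=> [|c' p1 p2 Sp1 _ IH]; first by rewrite scaler0; apply: lin_span_0.
by rewrite scalerDr scalerA; apply: lin_span_add.
Qed.

Lemma lin_span_B p q : lin_span S p -> lin_span S q -> lin_span S (p - q).
Proof. by move=> Sp Sq; rewrite -scaleN1r; apply/lin_span_D/lin_span_scale. Qed.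

Lemma lin_span_sum (I : Type) (sq : seq I) (F : I -> {mpoly K[N]}) :
  (forall i, lin_span S (F i)) -> lin_span S (\sum_(i <- sq) F i).
Proof. by move=> SF; apply: big_ind => //; [apply: lin_span_0 | apply: lin_span_D]. Qed.

Lemma lin_span_alg p : lin_span S p -> alg_gen S p.
Proof.
elim=> [|c p1 p2 Sp1 _ IH]; first exact: alg_gen_0.
by apply: alg_gen_add => //; apply/alg_gen_scale/alg_gen_in.
Qed.

Lemma lin_span_homog d p :
  (forall q, S q -> q \is d.-homog) -> lin_span S p -> p \is d.-homog.
Proof.
by move=> homS; elim=> [|c p1 p2 /homS ? _ IH]; rewrite ?rpred0 // rpredD ?rpredZ.
Qed.

End AlgGen.

(** This is the compatibility of linear and quadratic parts that the linear resolution requires. The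
    bound [k] exceeds [d] and all degrees in [a], so the component of degree [d] is among the
    summands. *)
Lemma pihomogM_homog (K : fieldType) N d e (a l : {mpoly K[N]}) :
  l \is e.-homog -> pihomog mdeg (d + e) (a * l) = pihomog mdeg d a * l.
Proof.
move=> hom_l; pose k := maxn (msize a) d.+1.
have a_lt : (mmeasure mdeg a <= k)%N by rewrite leq_maxl.
have d_lt : (d < k)%N by rewrite leq_maxr.
rewrite {1}(pihomog_partitionE a_lt) mulr_suml linear_sum (bigD1 (Ordinal d_lt)) //=.
have hom i : pihomog mdeg i a * l \is (i + e).-homog.
  by apply: dhomogM => //; apply: pihomogP.
rewrite (pihomog_dE (hom d)) big1 ?addr0 // => i ne_i.
by apply: (pihomog_ne0 _ (hom i)); rewrite eqn_add2r.
Qed.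

Section StraighteningLaw.

Variables (K : fieldType) (N M : nat) (r1 r2 : 'I_N -> nat).
Variables (gen : 'I_N -> {mpoly K[M]}) (Rel : {mpoly K[N]} -> Prop).
Local Notation phi := (comp_mpoly [tuple gen k | k < N]).
Implicit Types (k : 'I_N) (m : 'X_{1..N}).

Definition cle k k' := (r1 k <= r1 k')%N && (r2 k <= r2 k')%N.
(* Since squaring is convex, a nested pair outweighs the crossing and the
   disjoint pairs with the same four end points. *)
Definition weight m := (\sum_k m k * (r2 k - r1 k) ^ 2)%N.

Lemma weightD m m' : weight (m + m') = (weight m + weight m')%N.
Proof.
by rewrite /weight -big_split; apply: eq_bigr => k _; rewrite mnmDE mulnDl.
Qed.

Lemma weightU k : weight U_(k) = ((r2 k - r1 k) ^ 2)%N.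
Proof.
rewrite /weight (bigD1 k) //= mnm1E eqxx mul1n big1 ?addn0 // => k' /negPf kk'.
by rewrite mnm1E eq_sym kk'.
Qed.

Lemma cle_refl : reflexive cle.
Proof. by move=> k; rewrite /cle !leqnn. Qed.

Lemma cle_trans : transitive cle.
Proof.
move=> k2 k1 k3 /andP[h1 h2] /andP[h3 h4].
by rewrite /cle (leq_trans h1 h3) (leq_trans h2 h4).
Qed.

Definition standard m :=
  [forall k, forall k', (m k != 0%N) && (m k' != 0%N) ==> cle k k' || cle k' k].

Lemma standardP m : reflect
  (forall k k', m k != 0%N -> m k' != 0%N -> cle k k' || cle k' k) (standard m).
Proof.
apply: (iffP forallP) => [st k k' mk mk' | st k].
  by have /forallP/(_ k')/implyP := st k; rewrite mk mk'; apply.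
by apply/forallP => k'; apply/implyP => /andP[mk]; apply: st.
Qed.

Lemma standard_sub m m' : (forall k, m' k != 0%N -> m k != 0%N) ->
  standard m -> standard m'.
Proof. by move=> sub /standardP st; apply/standardP => k k' /sub mk /sub;
  apply: st. Qed.

(** In a chain, an element with the smallest sum of coordinates is least. *)
Lemma standard_min m : standard m -> m != 0%MM ->
  exists2 k, m k != 0%N & forall k', m k' != 0%N -> cle k k'.
Proof.
move=> /standardP st m0.
have [k0 mk0] : exists k, m k != 0%N.
  apply/existsP; apply: contraNT m0; rewrite negb_exists => /forallP m0.
  by apply/eqP/mnmP => k; rewrite mnm0E; have := m0 k; rewrite negbK => /eqP.
have [k mk mink] := @arg_minnP _ k0 (fun k => m k != 0%N) (fun k => r1 k + r2 k)%N mk0.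
exists k => // k' mk'; have := mink _ mk'; have := st k k' mk mk'.
by rewrite /cle; lia.
Qed.

Hypothesis r_inj : forall k k', r1 k = r1 k' -> r2 k = r2 k' -> k = k'.

Lemma cle_anti : antisymmetric cle.
Proof. by move=> k k'; rewrite /cle => le2; apply: r_inj; lia. Qed.

(** A three-term relation whose heaviest product belongs to an incomparable pair. The term [t] may
    be zero, since some minors of a sparse matrix vanish. *)
Definition exchange_law := forall a b, ~~ cle a b -> ~~ cle b a ->
  exists c d (t : {mpoly K[N]}),
  [/\ Rel ('X_a * 'X_b - 'X_c * 'X_d + t), cle c a && cle c b,
      (weight (U_(c) + U_(d)) < weight (U_(a) + U_(b)))%N
    & t = 0 \/ exists e g, [/\ t = 'X_e * 'X_g, cle e a && cle e b
        & (weight (U_(e) + U_(g)) < weight (U_(a) + U_(b)))%N]].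

(** * Straightening into standard monomials *)

Hypothesis exchange : exchange_law.
Hypothesis phi_Rel : forall p, Rel p -> phi p = 0.

Lemma phiU k : phi 'X_k = gen k.
Proof. by rewrite comp_mpolyXU -tnth_nth tnth_mktuple. Qed.

Lemma phiX m : phi 'X_[m] = \prod_k gen k ^+ m k.
Proof. by rewrite comp_mpolyX; apply: eq_bigr => k _; rewrite tnth_mktuple. Qed.

Lemma gen_exchange a b : ~~ cle a b -> ~~ cle b a ->
  exists c d, [/\ cle c a && cle c b,
      (weight (U_(c) + U_(d)) < weight (U_(a) + U_(b)))%N
    & gen a * gen b = gen c * gen d \/
      exists e g, [/\ gen a * gen b = gen c * gen d - gen e * gen g,
        cle e a && cle e b
        & (weight (U_(e) + U_(g)) < weight (U_(a) + U_(b)))%N]].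
Proof.
move=> nab nba; have [c [d [t [/phi_Rel pl cab wt tE]]]] := exchange nab nba.
exists c, d; split=> //.
move: pl; rewrite rmorphD rmorphB !rmorphM /= !phiU => /eqP.
case: tE => [-> | [e [g [-> eab wt']]]].
  by rewrite raddf0 addr0 subr_eq0 => /eqP; left.
rewrite rmorphM /= !phiU addr_eq0 subr_eq addrC => /eqP abE.
by right; exists e, g.
Qed.

Lemma nonstandardP m : ~~ standard m -> exists a b m0,
  [/\ ~~ cle a b, ~~ cle b a & m = (m0 + (U_(a) + U_(b)))%MM].
Proof.
move=> /forallPn[a /forallPn[b]]; rewrite negb_imply negb_or.
case/andP=> /andP[ma mb] /andP[nab nba].
exists a, b, (m - (U_(a) + U_(b)))%MM; split=> //.
have ab : a != b by apply: contraNneq nab => ->; apply: cle_refl.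
rewrite submK //; apply/mnm_lepP => k; rewrite !mnmE.
case: (a =P k) => [<-|_]; last by case: (b =P k) => [<-|//]; rewrite lt0n.
by rewrite eq_sym (negPf ab) addn0 lt0n.
Qed.

(* [lowers m m'] says that [m'] may occur in the straightening of [m]. *)
Definition lowers m m' :=
  [/\ standard m', m' = m \/ (weight m' < weight m)%N
    & forall k, m k != 0%N -> exists2 k', m' k' != 0%N & cle k' k].

(** Induction on the weight: the product of an incomparable pair dividing [m] is replaced by one or
    two products of smaller weight, each with a factor below both members of the pair. *)
Lemma straighten_mnm m :
  exists2 q, phi q = phi 'X_[m] & forall m', q@_m' != 0 -> lowers m m'.
Proof.
have [w] := ubnP (weight m); elim: w => // w IHw in m * => ltw.
have [st | nst] := boolP (standard m).
  exists 'X_[m] => // m'; rewrite mcoeffX; case: (m =P m') => [<- _|];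
    last by rewrite eqxx.
  by split=> //; [left | move=> k; exists k => //; apply: cle_refl].
have [a [b [m0 [nab nba mE]]]] := nonstandardP nst.
have step c d : cle c a && cle c b ->
    (weight (U_(c) + U_(d)) < weight (U_(a) + U_(b)))%N ->
    exists2 q, phi q = phi 'X_[m0] * (gen c * gen d)
      & forall m', q@_m' != 0 -> lowers m m'.
  move=> /andP[ca cb] wt; pose m1 := (m0 + (U_(c) + U_(d)))%MM.
  have wt1 : (weight m1 < weight m)%N by rewrite mE /m1 !(weightD m0) ltn_add2l.
  have [|q qE qlow] := IHw m1; first exact: leq_trans wt1 _.
  exists q => [|m' /qlow[st' wt' low]].
    by rewrite qE !mpolyXD !rmorphM /= !phiU.
  split=> // [|k mk]; first by right; case: wt' => [->|/ltn_trans->].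
  (* A variable of [m] either survives in [m1] or is [a] or [b], and then [c] lies below it. *)
  have [k' lek' m1k'] : exists2 k', cle k' k & m1 k' != 0%N.
    have m1c : m1 c != 0%N by rewrite !mnmE eqxx addnCA.
    have [-> | ka] := eqVneq k a; first by exists c.
    have [-> | kb] := eqVneq k b; first by exists c.
    exists k; first exact: cle_refl.
    move: mk; rewrite mE !mnmE (eq_sym a) (eq_sym b) (negPf ka) (negPf kb) addn0.
    by rewrite addn_eq0 negb_and => ->.
  have [k'' m'k'' lek''] := low _ m1k'; exists k'' => //.
  exact: cle_trans lek'' lek'.
have [c [d [cab wt cd]]] := gen_exchange nab nba.
have [q1 q1E q1low] := step _ _ cab wt.
have -> : phi 'X_[m] = phi 'X_[m0] * (gen a * gen b).
  by rewrite mE !mpolyXD !rmorphM /= !phiU.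
case: cd => [-> | [e [g [-> eab wt']]]]; first by exists q1.
have [q2 q2E q2low] := step _ _ eab wt'.
exists (q1 - q2); first by rewrite rmorphB /= q1E q2E mulrBr.
move=> m'; have [q1m' | /q1low//] := eqVneq q1@_m' 0.
by rewrite mcoeffB q1m' sub0r oppr_eq0; apply: q2low.
Qed.

Lemma sum_support (I : eqType) (sq : seq I) (F : I -> {mpoly K[N]}) m :
  (\sum_(i <- sq) F i)@_m != 0 -> exists2 i, i \in sq & (F i)@_m != 0.
Proof.
rewrite raddf_sum /= => sum_neq0; apply/hasP; apply: contraNT sum_neq0 => /hasPn no.
by rewrite big_seq big1 // => i /no; rewrite negbK => /eqP.
Qed.

Lemma straighten p : exists2 q, phi q = phi p
  & forall m', q@_m' != 0 -> exists2 m, p@_m != 0 & lowers m m'.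
Proof.
have [st stE] := choice (fun m q => phi q = phi 'X_[m] /\
    forall m', q@_m' != 0 -> lowers m m')
  (fun m => let: ex_intro2 q qE ql := straighten_mnm m in ex_intro _ q (conj qE ql)).
exists (\sum_(m <- msupp p) p@_m *: st m).
  rewrite [in RHS](mpolyE p) !linear_sum; apply: eq_bigr => m _ /=.
  by rewrite !linearZ /=; case: (stE m) => ->.
move=> m' /sum_support[m mp]; rewrite mcoeffZ mulf_eq0 negb_or => /andP[pm stm].
by exists m => //; apply: (proj2 (stE m)).
Qed.

Variable S : {mpoly K[M]} -> Prop.
Hypotheses (S_gen : forall k, S (gen k))
  (S_cases : forall p, S p -> p = 0 \/ exists k, p = gen k).

Lemma alg_gen_phi a : alg_gen S a <-> exists p, a = phi p.
Proof.
split=> [|[p ->]].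
  elim=> [q /S_cases[->|[k ->]] | c | q q' _ [p ->] _ [p' ->] | q q' _ [p ->] _ [p' ->]].
  - by exists 0; rewrite raddf0.
  - by exists 'X_k; rewrite phiU.
  - by exists c%:MP; rewrite comp_mpolyC.
  - by exists (p + p'); rewrite raddfD.
  - by exists (p * p'); rewrite rmorphM.
rewrite comp_mpolyEX; apply: alg_gen_sum => m; apply: alg_gen_scale.
by rewrite phiX; apply: alg_gen_prod => k; apply/alg_gen_exp/alg_gen_in.
Qed.

(** * Initial monomials and linear independence of the standard monomials *)

Section Leading.

Variables (tau : rel 'X_{1..M}) (fa fb : 'I_N -> 'I_M).
Hypothesis tau_term : term_order tau.
Hypotheses (fa_inj : forall k k', (fa k == fa k') = (r1 k == r1 k'))
  (fb_inj : forall k k', (fb k == fb k') = (r2 k == r2 k'))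
  (fafb : forall k k', fa k != fb k').
Hypothesis leading_gen : forall k, leading tau (gen k) (U_(fa k) + U_(fb k)).

(** The exponent of the initial monomial of [phi 'X_[m]]. *)
Definition rho m : 'X_{1..M} := (\sum_k (U_(fa k) + U_(fb k)) *+ m k)%MM.

Lemma rhoE m a : rho m a = (\sum_k ((fa k == a) + (fb k == a)) * m k)%N.
Proof. by rewrite /rho mnm_sumE; apply: eq_bigr => k _; rewrite mulmnE !mnmE. Qed.

Lemma rhoD m m' : rho (m + m') = (rho m + rho m')%MM.
Proof.
apply/mnmP => a; rewrite mnmDE !rhoE -big_split; apply: eq_bigr => k _ /=.
by rewrite mnmDE mulnDr.
Qed.

Lemma rho_neq0 m a : (rho m a != 0%N) =
  [exists k, ((fa k == a) || (fb k == a)) && (m k != 0%N)].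
Proof.
rewrite rhoE sum_nat_eq0 negb_forall; apply: eq_existsb => k /=.
by rewrite muln_eq0 negb_or addn_eq0 !eqb0 negb_and !negbK.
Qed.

Lemma rho_fst m m' k : rho m = rho m' -> m k != 0%N ->
  exists2 k', m' k' != 0%N & r1 k' = r1 k.
Proof.
move=> mm' mk; have : rho m (fa k) != 0%N.
  by rewrite rho_neq0; apply/existsP; exists k; rewrite mk eqxx.
rewrite mm' rho_neq0 => /existsP[k' /andP[]].
by rewrite fa_inj [fb _ == _]eq_sym (negPf (fafb _ _)) orbF => /eqP; exists k'.
Qed.

Lemma rho_snd m m' k : rho m = rho m' -> m k != 0%N ->
  exists2 k', m' k' != 0%N & r2 k' = r2 k.
Proof.
move=> mm' mk; have : rho m (fb k) != 0%N.
  by rewrite rho_neq0; apply/existsP; exists k; rewrite mk eqxx orbT.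
rewrite mm' rho_neq0 => /existsP[k' /andP[]].
by rewrite (negPf (fafb _ _)) fb_inj => /eqP; exists k'.
Qed.

(* The least element of a chain is read off from its row indices and its
   column indices separately. *)
Lemma rho_inj m m' : standard m -> standard m' -> rho m = rho m' -> m = m'.
Proof.
have [d] := ubnP (mdeg m); elim: d => // d IHd in m m' * => ltd st st' mm'.
have [m0 | m_neq0] := eqVneq m 0%MM.
  have [-> // | /(standard_min st')[k m'k _]] := eqVneq m' 0%MM.
  by have [k'] := rho_fst (esym mm') m'k; rewrite m0 mnm0E.
have [k mk mink] := standard_min st m_neq0.
have m'_neq0 : m' != 0%MM.
  have [k' m'k' _] := rho_fst mm' mk.
  by apply: contraNneq m'k' => ->; rewrite mnm0E.
have [k' m'k' mink'] := standard_min st' m'_neq0.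
have kk' : k' = k.
  (* [k1] and [k2] are variables of [m'] sharing the first, respectively second, index with [k].
     They lie above [k'], so both indices of [k'] are at most those of [k]; [k3] and [k4] give the
     converse. *)
  have [k1 /mink' m'k1 k1E] := rho_fst mm' mk.
  have [k2 /mink' m'k2 k2E] := rho_snd mm' mk.
  have [k3 /mink mk3 k3E] := rho_fst (esym mm') m'k'.
  have [k4 /mink mk4 k4E] := rho_snd (esym mm') m'k'.
  by apply: cle_anti; move: m'k1 m'k2 mk3 mk4; rewrite /cle; lia.
rewrite {}kk' in m'k' mink'.
have mU : (m - U_(k) + U_(k))%MM = m by rewrite submK // lep1mP.
have m'U : (m' - U_(k) + U_(k))%MM = m' by rewrite submK // lep1mP.
rewrite -mU -m'U; congr (_ + _)%MM; apply: IHd.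
- by rewrite -ltnS; apply: leq_trans ltd; rewrite -{2}mU mdegD mdeg1 addn1.
- by apply: standard_sub st => k0; rewrite mnmBE; lia.
- by apply: standard_sub st' => k0; rewrite mnmBE; lia.
by apply: (@addIm _ (rho U_(k))); rewrite -!rhoD mU m'U.
Qed.

Lemma leading_phiX m : leading tau (phi 'X_[m]) (rho m).
Proof. by rewrite phiX; apply: leading_prod => // k; apply: leadingXn. Qed.

(** By [rho_inj], the images of different standard monomials have different initial monomials, so
    the largest one cannot cancel. *)
Lemma leading_phi q : q != 0 -> (forall m, q@_m != 0 -> standard m) ->
  exists m, leading tau (phi q) (rho m).
Proof.
move=> q0 st; have := exists_le_max tau_term rho (s := msupp q).
rewrite msupp_eq0 => /(_ q0)[m mq maxm]; exists m.
have phiE t : (phi q)@_t = \sum_(m' <- msupp q) q@_m' * (phi 'X_[m'])@_t.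
  rewrite comp_mpolyEX raddf_sum /=; apply: eq_bigr => m' _.
  by rewrite mcoeffZ.
split=> [|t].
  rewrite phiE (bigD1_seq m) //= big_seq_cond big1 ?addr0.
    by rewrite mulf_neq0 -?mcoeff_msupp //; case: (leading_phiX m);
      rewrite mcoeff_msupp.
  move=> m' /andP[m'q m'm]; apply/eqP; apply: contraNT m'm.
  rewrite mulf_eq0 negb_or => /andP[_ ph]; apply/eqP.
  apply: rho_inj; try by apply: st; rewrite -mcoeff_msupp.
  apply: (term_anti tau_term); rewrite maxm //=.
  by case: (leading_phiX m') => _; apply.
rewrite phiE => sum_neq0.
have /hasP[m' m'q] : has (fun m' => q@_m' * (phi 'X_[m'])@_t != 0) (msupp q).
  apply: contraNT sum_neq0 => /hasPn no; rewrite big_seq big1 // => m' /no.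
  by rewrite negbK => /eqP.
rewrite mulf_eq0 negb_or => /andP[_ ph]; apply: (term_trans tau_term) (maxm _ m'q).
by case: (leading_phiX m') => _; apply.
Qed.

Lemma phi_standard_inj q : (forall m, q@_m != 0 -> standard m) -> phi q = 0 -> q = 0.
Proof.
move=> st ph; apply/eqP; apply: contraTT isT => q0.
by have [m /leading_neq0] := leading_phi q0 st; rewrite ph eqxx.
Qed.

(** After straightening a preimage, the initial monomial of an element of the algebra is some
    [rho m], a product of initial monomials of generators. *)
Lemma init_alg_gen p : init_alg tau (alg_gen S) p ->
  alg_gen (fun q => exists k, q = 'X_[init_mnm tau (gen k)]) p.
Proof.
apply: alg_gen_sub => _ [a [/alg_gen_phi[p' ->] a0 ->]].
have [q qE qlow] := straighten p'.
have q0 : q != 0 by apply: contraNneq a0 => q0; rewrite -qE q0 raddf0.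
have [m lead] := leading_phi q0 (fun m qm => let: ex_intro2 _ _ (And3 st _ _) :=
  qlow m qm in st).
rewrite -qE (leading_init tau_term lead) /rho.
have XS : {morph (fun t => 'X_[t] : {mpoly K[M]}) : t t' / (t + t')%MM >-> t * t'}.
  exact: mpolyXD.
rewrite (big_morph _ XS (mpolyX0 _ _)); apply: alg_gen_prod => k.
rewrite -mpolyXn; apply/alg_gen_exp/alg_gen_in; exists k.
by rewrite (leading_init tau_term (leading_gen k)).
Qed.

End Leading.

(** * The Groebner basis, for the weight refined by the standard order on monomials *)

Definition weight_le m m' :=
  (weight m < weight m')%N || (weight m == weight m') && (m <= m')%O.

Lemma weight_le_term : term_order weight_le.
Proof.
rewrite /weight_le; split.
- move=> m m' /andP[/orP[lt|/andP[/eqP e le]] /orP[lt'|/andP[/eqP e' le']]].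
  + by have := ltn_trans lt lt'; rewrite ltnn.
  + by rewrite e' ltnn in lt.
  + by rewrite e ltnn in lt'.
  + by apply: Order.POrderTheory.le_anti; rewrite le le'.
- move=> m2 m1 m3 /orP[lt|/andP[/eqP-> le]] /orP[lt'|/andP[/eqP e' le']].
  + by rewrite (ltn_trans lt lt').
  + by rewrite -e' lt.
  + by rewrite lt'.
  + by rewrite e' eqxx (Order.POrderTheory.le_trans le le') orbT.
- move=> m m'; case: ltngtP => //= _; exact: Order.TotalTheory.le_total.
- move=> m; rewrite le0m andbT orbC -leq_eqVlt.
  by rewrite /weight big1 // => k _; rewrite mnm0E mul0n.
move=> m m1 m2; rewrite !weightD ltn_add2r eqn_add2r.
by rewrite lemc_add2l.
Qed.

Lemma plucker_leading a b c d (t : {mpoly K[N]}) :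
  (weight (U_(c) + U_(d)) < weight (U_(a) + U_(b)))%N ->
  t = 0 \/ (exists e g, t = 'X_e * 'X_g /\
    (weight (U_(e) + U_(g)) < weight (U_(a) + U_(b)))%N) ->
  leading weight_le ('X_a * 'X_b - 'X_c * 'X_d + t) (U_(a) + U_(b)).
Proof.
move=> wt tE; set w := weight (U_(a) + U_(b)) in wt tE.
have t_low m : t@_m != 0 -> (weight m < w)%N.
  case: tE => [-> | [e [g [-> wt']]]]; first by rewrite mcoeff0 eqxx.
  by rewrite -mpolyXD mcoeffX; case: (_ =P m) => [<-|_] //; rewrite eqxx.
rewrite -!mpolyXD; split=> [|m]; rewrite mcoeffD mcoeffB !mcoeffX.
  have /eqP-> : t@_(U_(a) + U_(b)) == 0.
    by apply: contraT => /t_low; rewrite ltnn.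
  rewrite eqxx addr0; case: ((U_(c) + U_(d))%MM =P _) => [e | _];
    last by rewrite subr0 oner_neq0.
  by rewrite /w -e ltnn in wt.
case: (_ =P m) => [<- _|_]; first exact: term_refl weight_le_term _.
rewrite sub0r; case: (_ =P m) => [<- _|_]; first by rewrite /weight_le wt.
by rewrite oppr0 add0r => /t_low lt; rewrite /weight_le lt.
Qed.

Hypothesis phi_injP : forall q, (forall m, q@_m != 0 -> standard m) -> phi q = 0 -> q = 0.

(** Were the initial monomial [m] standard, straightening the other terms would give a standard
    combination in the kernel, hence zero. So [m] would have to arise from another term of [p], but
    those yield only themselves or monomials lighter than themselves, and none is heavier than
    [m]. *)
Lemma ker_init_nonstandard p :
  p != 0 -> phi p = 0 -> ~~ standard (init_mnm weight_le p).
Proof.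
move=> p0 ph; set m := init_mnm _ _; apply/negP => st.
have [pm maxm] := init_mnm_leading weight_le_term p0; rewrite -/m in pm maxm.
pose p' := p - p@_m *: 'X_[m].
have p'E m' : p'@_m' = if m' == m then 0 else p@_m'.
  rewrite mcoeffB mcoeffZ mcoeffX eq_sym; case: (m' =P m) => [->|_].
    by rewrite mulr1 subrr.
  by rewrite mulr0 subr0.
have [q qE qlow] := straighten p'.
have q0 : p@_m *: 'X_[m] + q = 0.
  apply: phi_injP.
    move=> k; have [-> // | km] := eqVneq k m.
    rewrite mcoeffD mcoeffZ mcoeffX [m == k]eq_sym (negPf km) mulr0 add0r.
    by case/qlow=> ? _ [].
  by rewrite linearD /= qE -linearD /= /p' addrC subrK.
have /qlow[k] : q@_m != 0.
  apply: contraNneq pm => qm; move/(congr1 (mcoeff m)): q0.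
  by rewrite mcoeffD mcoeffZ mcoeffX eqxx mulr1 qm addr0 mcoeff0 => ->.
rewrite p'E; case: (k =P m) => [_|km pk [_ [mk|lt] _]]; first by rewrite eqxx.
  by rewrite mk in km.
have := maxm _ pk; rewrite /weight_le => /orP[lt'|/andP[/eqP e _]].
  by have := ltn_trans lt lt'; rewrite ltnn.
by rewrite e ltnn in lt.
Qed.

(** A nonstandard initial monomial is divisible by the product of an incomparable pair, which is the
    initial monomial of the exchange relation of that pair. *)
Lemma plucker_groebner : is_groebner weight_le Rel (fun p => phi p = 0).
Proof.
split=> // p; split; last first.
  elim=> [|a x q [p0 [PRp0 p0_neq0 ->]] _ IH]; first exact: ideal_gen_0.
  by apply: ideal_gen_add IH; exists p0; split=> //; apply: phi_Rel.
elim=> [|a x q [p0 [ph p0_neq0 ->]] _ IH]; first exact: ideal_gen_0.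
have [e [g [m0 [neg nge mE]]]] := nonstandardP (ker_init_nonstandard p0_neq0 ph).
have [c [d [t [PRt _ wt tE]]]] := exchange neg nge.
have lead : leading weight_le ('X_e * 'X_g - 'X_c * 'X_d + t) (U_(e) + U_(g)).
  apply: plucker_leading => //.
  by case: tE => [|[e' [g' [? _ ?]]]]; [left | right; exists e', g'].
rewrite mE mpolyXD mulrA; apply: ideal_gen_add IH.
exists ('X_e * 'X_g - 'X_c * 'X_d + t); split=> //; first exact: leading_neq0 lead.
by rewrite (leading_init weight_le_term lead).
Qed.

(** * Koszulness: linear parts, straightened products and colon ideals *)

Hypothesis gen_homog : forall k, gen k \is 2.-homog.

Lemma phiX_homog m : phi 'X_[m] \is (2 * mdeg m).-homog.
Proof.
rewrite phiX mdegE big_distrr /=.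
apply: (big_rec2 (fun (p : {mpoly K[M]}) d => p \is d.-homog)) => [|k d p _ hp].
  exact: dhomog1.
by apply: dhomogM => //; apply: dhomogMn.
Qed.

Lemma S_homog p : S p -> p \is 2.-homog.
Proof. by case/S_cases=> [->|[k ->]] //; apply: rpred0. Qed.

(** A monomial of degree [d] has an image of degree [2 * d], so only the variables contribute in
    degree 2. *)
Lemma linear_part a : alg_gen S a -> lin_span S (pihomog mdeg 2 a).
Proof.
case/alg_gen_phi=> p ->; rewrite comp_mpolyEX linear_sum; apply: lin_span_sum => m.
rewrite linearZ; apply: lin_span_scale => /=.
have [/mdeg1P[k /eqP->] | ne1] := boolP (mdeg m == 1%N).
  by rewrite phiU pihomog_dE //; apply: lin_span_in.
rewrite (pihomog_ne0 _ (phiX_homog m)); first exact: lin_span_0.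
by move: ne1; lia.
Qed.

Lemma sum_single k (a : {mpoly K[M]}) (Q : pred 'I_N) : Q k ->
  \sum_(t | Q t) (if t == k then a else 0) * gen t = a * gen k.
Proof.
move=> Qk; rewrite (bigD1 k) //= eqxx big1 ?addr0 // => t /andP[_ /negPf->].
by rewrite mul0r.
Qed.

Lemma phi_in_ideal (Q : pred 'I_N) p :
  (forall m, p@_m != 0 -> exists2 u, m u != 0%N & Q u) ->
  exists2 c, forall u, alg_gen S (c u) & phi p = \sum_(u | Q u) c u * gen u.
Proof.
move=> pQ; rewrite comp_mpolyEX big_seq.
apply: (big_ind (fun x => exists2 c, forall u, alg_gen S (c u)
  & x = \sum_(u | Q u) c u * gen u)).
- exists (fun=> 0) => [u|]; first exact: alg_gen_0.
  by rewrite big1 // => u _; rewrite mul0r.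
- move=> x x' [c Ac ->] [c' Ac' ->]; exists (fun u => c u + c' u) => [u|].
    exact: alg_gen_add.
  by rewrite -big_split; apply: eq_bigr => u _; rewrite mulrDl.
move=> m; rewrite mcoeff_msupp => /pQ[u mu Qu].
have phi_m : phi 'X_[m] = phi 'X_[m - U_(u)] * gen u.
  by rewrite -phiU -rmorphM -mpolyXD submK // lep1mP.
exists (fun t => if t == u then p@_m *: phi 'X_[m - U_(u)] else 0) => [t|].
  case: eqP => _; last exact: alg_gen_0.
  by apply/alg_gen_scale/alg_gen_phi; exists 'X_[m - U_(u)].
by rewrite sum_single // phi_m scalerAl.
Qed.

(** If [u] is below [v], the product already has the required form. Otherwise the exchange law
    applies; its [c] and [e] lie below [u], hence differ from [v]. *)
Lemma gen_straight v u : ~~ cle v u -> exists l : 'I_N -> {mpoly K[M]},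
  [/\ forall t, lin_span S (l t), forall t, ~~ below cle v t -> l t = 0
    & \sum_t l t * gen t = gen v * gen u].
Proof.
move=> nvu; have linF (Q : bool) k : lin_span S (if Q then gen k else 0).
  by case: Q; [apply: lin_span_in | apply: lin_span_0].
have belowP k : cle k v -> cle k u -> below cle v k.
  by move=> kv ku; rewrite /below kv andbT; apply: contraNneq nvu => <-.
have single_below k a t : cle k v -> cle k u -> ~~ below cle v t ->
    (if t == k then a else 0) = 0 :> {mpoly K[M]}.
  by move=> kv ku; case: eqP => // ->; rewrite belowP.
have [uv | nuv] := boolP (cle u v).
  exists (fun t => if t == u then gen v else 0); split=> // [t|].
    by apply: single_below => //; apply: cle_refl.
  exact: sum_single.
have [c [d [/andP[cv cu] _ [-> | [e [g [-> /andP[ev eu] _]]]]]]] :=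
  gen_exchange nvu nuv.
  exists (fun t => if t == c then gen d else 0); split=> // [t|].
    exact: single_below.
  by rewrite sum_single // mulrC.
exists (fun t => (if t == c then gen d else 0) - (if t == e then gen g else 0)).
split=> [t|t nb|]; first exact: lin_span_B.
  by rewrite !single_below // subrr.
under eq_bigr do rewrite mulrBl.
by rewrite sumrB !sum_single // mulrC [gen g * _]mulrC.
Qed.

Lemma restrict_coeff (Q : pred 'X_{1..N}) (p : {mpoly K[N]}) t :
  (\sum_(m <- msupp p | Q m) p@_m *: 'X_[m])@_t = if Q t then p@_t else 0.
Proof.
rewrite raddf_sum /= -big_filter; under eq_bigr do rewrite mcoeffZ mcoeffX.
have [tin | tnin] := boolP (t \in [seq m <- msupp p | Q m]).
  rewrite (bigD1_seq t) //=; last by rewrite filter_uniq ?msupp_uniq.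
  rewrite eqxx mulr1 big1 ?addr0 => [|m /negPf->]; last by rewrite mulr0.
  by move: tin; rewrite mem_filter => /andP[->].
rewrite big_seq big1 => [|m mm].
  by move: tnin; rewrite mem_filter mcoeff_msupp; case: (Q t) => //=;
    rewrite negbK => /eqP.
by case: eqP => [mt|]; rewrite ?mulr0 //; rewrite -mt mm in tnin.
Qed.

Lemma mulXU_coeff (p : {mpoly K[N]}) u t : (p * 'X_u)@_t != 0 ->
  exists2 m, p@_m != 0 & t = (m + U_(u))%MM.
Proof.
rewrite -mcoeff_msupp => /msuppM_le/allpairsP[[m m'] /=].
by rewrite msuppX inE mcoeff_msupp => -[pm /eqP-> ->]; exists m.
Qed.

Lemma gen_colon v a (c : 'I_N -> {mpoly K[M]}) : alg_gen S a ->
  (forall u, alg_gen S (c u)) ->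
  a * gen v = \sum_(u | ~~ cle v u) c u * gen u ->
  exists2 c' : 'I_N -> {mpoly K[M]}, forall u, alg_gen S (c' u)
    & a = \sum_(u | ~~ cle v u) c' u * gen u.
Proof.
move=> /alg_gen_phi[p ->] Ac pv.
have [q qE qlow] := straighten p; rewrite -{}qE in pv *.
have [B BE] := choice _ (fun u => proj1 (alg_gen_phi _) (Ac u)).
(* [q1] collects the monomials of [q] all of whose variables are above [v]. The rest [q2] maps into
   the ideal, so it suffices that [q1] vanishes. *)
pose above m := [forall k, (m k != 0%N) ==> cle v k].
pose q1 := \sum_(m <- msupp q | above m) q@_m *: 'X_[m].
have q1E m : q1@_m = if above m then q@_m else 0 by apply: restrict_coeff.
pose q2 := q - q1.
have q2E m : q2@_m != 0 -> q@_m != 0 /\ ~~ above m.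
  by rewrite mcoeffB q1E; case: ifP; rewrite ?subrr ?eqxx ?subr0.
have naboveP m : ~~ above m -> exists2 u, m u != 0%N & ~~ cle v u.
  by case/forallPn=> u; rewrite negb_imply => /andP[]; exists u.
suff q1_0 : q1 = 0.
  apply: phi_in_ideal => m qm; apply: naboveP.
  by apply: (q2E m _).2; rewrite /q2 q1_0 subr0.
(* [w] has the same image as [q1 * 'X_v], but each of its monomials has a variable not above [v].
   Straightening preserves this by the last clause of [lowers]. *)
pose w := \sum_(u | ~~ cle v u) B u * 'X_u - q2 * 'X_v.
have wE : phi w = phi (q1 * 'X_v).
  rewrite /w rmorphB rmorph_sum !rmorphM /= phiU.
  have -> : \sum_(u | ~~ cle v u) phi (B u * 'X_u) = phi q * gen v.
    by rewrite pv; apply: eq_bigr => u _; rewrite rmorphM /= phiU BE.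
  by rewrite -mulrBl -rmorphB /q2 opprB addrC subrK.
have [q' q'E q'low] := straighten w.
have w_low t : w@_t != 0 -> exists2 u, t u != 0%N & ~~ cle v u.
  move=> wt; have [q2t | q2t] := eqVneq (q2 * 'X_v)@_t 0; last first.
    have [m /q2E[_ /naboveP[u mu nvu]] ->] := mulXU_coeff q2t.
    by exists u => //; rewrite mnmDE addn_eq0 negb_and mu.
  have : (\sum_(u | ~~ cle v u) B u * 'X_u)@_t != 0.
    by move: wt; rewrite mcoeffB q2t subr0.
  rewrite -big_filter => /sum_support[u]; rewrite mem_filter => /andP[nvu _].
  case/mulXU_coeff=> m _ ->; exists u => //.
  by rewrite mnmDE mnm1E eqxx addnC.
(* Multiplying by ['X_v] keeps these monomials standard, as [v] is below all their variables. *)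
have q1v t : (q1 * 'X_v)@_t != 0 -> standard t /\ forall k, t k != 0%N -> cle v k.
  case/mulXU_coeff=> m; rewrite q1E; case: ifP; last by rewrite eqxx.
  move=> /forallP abm qm ->; have [m' _ [st _ _]] := qlow m qm.
  have abt k : (m + U_(v))%MM k != 0%N -> cle v k.
    rewrite mnmDE mnm1E; have [-> _ | _] := eqVneq v k; first exact: cle_refl.
    by rewrite addn0; apply/implyP.
  split=> //; apply/standardP => k k' mk mk'.
  have [vk | vk] := eqVneq v k; first by rewrite -vk abt.
  have [vk' | vk'] := eqVneq v k'; first by rewrite -vk' abt ?orbT.
  have /standardP := st; apply.
    by move: mk; rewrite mnmDE mnm1E (negPf vk) addn0.
  by move: mk'; rewrite mnmDE mnm1E (negPf vk') addn0.
(* Two standard polynomials with the same image are equal; here their supports are also disjoint, so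
   both vanish. *)
have D0 : q1 * 'X_v - q' = 0.
  apply: phi_injP; last by rewrite rmorphB /= q'E wE subrr.
  move=> t; have [q't | /q'low[m _ []//]] := eqVneq q'@_t 0.
  by rewrite mcoeffB q't subr0 => /q1v[].
apply/mpolyP => m; rewrite mcoeff0; apply/eqP; apply: contraT => q1m.
have tE : (q1 * 'X_v)@_(U_(v) + m) != 0 by rewrite mcoeffMX.
have [_ ab] := q1v _ tE.
have : q'@_(U_(v) + m) != 0 by move/eqP: D0; rewrite subr_eq0 => /eqP <-.
case/q'low=> t /w_low[u tu nvu] [_ _ low].
have [k tk ku] := low u tu.
by rewrite (cle_trans (ab _ tk) ku) in nvu.
Qed.

Lemma augmentation a : alg_gen S a -> a@_0 = 0 <->
  exists2 c, forall u, alg_gen S (c u) & a = \sum_u c u * gen u.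
Proof.
have sum0 (c : 'I_N -> {mpoly K[M]}) : (\sum_u c u * gen u)@_0 = 0.
  rewrite raddf_sum big1 // => u _; rewrite /= rmorphM /=.
  have -> : (gen u)@_0 = 0 by apply: (dhomog_nemf_coeff (gen_homog u));
    rewrite /= mdeg0.
  by rewrite mulr0.
case/alg_gen_phi=> p ->; split=> [p0 | [c _ ->] //].
have pE : p = (p@_0)%:MP + (p - (p@_0)%:MP) by rewrite addrC subrK.
have p'0 m : (p - (p@_0)%:MP)@_m != 0 -> exists2 u, m u != 0%N & predT u.
  rewrite mcoeffB mcoeffC; have [<- | m0 _] := eqVneq 0%MM m.
    by rewrite mulr1 subrr eqxx.
  have : m != 0%MM by rewrite eq_sym.
  rewrite -mdeg_eq0 mdegE sum_nat_eq0 => /forallPn[u].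
  by rewrite implyTb => mu; exists u.
have [c Ac cE] := phi_in_ideal p'0.
exists c => //; rewrite -cE.
suff -> : p@_0 = 0 by rewrite subr0.
by move: p0; rewrite {1}pE raddfD raddfD /= comp_mpolyC cE sum0 addr0 mcoeffC eqxx mulr1.
Qed.

(** Degrees 2 and 4 of the polynomial ring are degrees 1 and 2 of the subalgebra, so these
    components serve as linear and quadratic parts. *)
Theorem koszul_gen : koszul S.
Proof.
have lin_id l : lin_span S l -> pihomog mdeg 2 l = l.
  by move=> linl; apply/pihomog_dE/(lin_span_homog S_homog).
have prM a l : alg_gen S a -> lin_span S l ->
    pihomog mdeg 4 (a * l) = pihomog mdeg 2 a * l.
  by move=> _ linl; apply/(@pihomogM_homog _ _ 2 2)/(lin_span_homog S_homog).
have [] := @linear_resolution _ _ cle cle_refl cle_anti cle_trans gen (alg_gen S)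
  (lin_span S) (alg_gen_0 S) (@alg_gen_sub2 _ _ S) (@alg_gen_mul _ _ S)
  (@lin_span_0 _ _ S) (@lin_span_B _ _ S) (@lin_span_alg _ _ S)
  (pihomog mdeg 2) (pihomog mdeg 4) linear_part lin_id prM
  (fun k => lin_span_in (S_gen k)) gen_straight gen_colon
  (fun a => a@_0 = 0) augmentation.
by move=> b [d bd]; exists b, d.
Qed.

End StraighteningLaw.

(** * The minors of a sparse matrix *)

Lemma det2 (R : comNzRingType) (A : 'M[R]_2) :
  \det A = A 0 0 * A 1 1 - A 0 1 * A 1 0.
Proof.
rewrite (expand_det_row _ 0) big_ord_recl big_ord1 /cofactor !det_mx11 !mxE /=.
rewrite add0n expr0 mul1r expr1 mulN1r mulrN.
have l1 : lift 0 0 = 1 :> 'I_2 by apply/val_inj.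
have l0 : lift 1 0 = 0 :> 'I_2 by apply/val_inj.
by rewrite !(l1, l0).
Qed.

(** The Pluecker identity holds for any two rows [u] and [v]; this generality leaves [ring] with
    plain variables instead of matrix entries. *)
Lemma comp_plucker (K : fieldType) (N M : nat) (lq : N.-tuple {mpoly K[M]})
    (a b c d e f : {mpoly K[N]}) (I : Type) (u v : I -> {mpoly K[M]}) i j k l :
  a \mPo lq = u i * v j - u j * v i -> b \mPo lq = u k * v l - u l * v k ->
  c \mPo lq = u i * v k - u k * v i -> d \mPo lq = u j * v l - u l * v j ->
  e \mPo lq = u i * v l - u l * v i -> f \mPo lq = u j * v k - u k * v j ->
  (a * b - c * d + e * f) \mPo lq = 0.
Proof. by move=> aE bE cE dE eE fE;
  rewrite rmorphD rmorphB !rmorphM /= aE bE cE dE eE fE; ring. Qed.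

Section SparseMinors.

Variables (K : fieldType) (n r s : nat).
Local Notation N := #|{: yvar K n r s}|.
Local Notation M := #|{: xvar n r s}|.
Local Notation minor := (@minor2 K n r s).
Local Notation X := (@sparse_mx K n r s).
Implicit Types (i j : 'I_n) (k : 'I_N) (m : 'X_{1..N}).

Lemma minor2E i j : minor i j = X 0 i * X 1 j - X 0 j * X 1 i.
Proof.
have colE a b : colsub (fun k : 'I_2 => if k == 0 then i else j) X a b
    = X a (if b == 0 then i else j) by rewrite mxE.
by rewrite /minor2 det2 !colE.
Qed.

Lemma sparse_mxP (p : 'I_2) j : nz_entry r s (p, j) ->
  exists2 a : 'I_M, X p j = 'X_a & val (enum_val a) = (p, j).
Proof.
move=> nz; rewrite mxE insubT; exists (enum_rank (Sub (p, j) nz : xvar n r s)) => //.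
by rewrite enum_rankK.
Qed.

Lemma sparse_mx0 (p : 'I_2) j : ~~ nz_entry r s (p, j) -> X p j = 0.
Proof. by move=> nz; rewrite mxE insubN. Qed.

(** If the condition fails, one row vanishes in both columns. If it holds, the diagonal product
    cannot cancel, since its variable [a] is absent from the other product. *)
Lemma minor2_neq0 i j : (i < j)%N -> (minor i j != 0) = (i < r + s)%N && (r <= j)%N.
Proof.
move=> ij; rewrite minor2E.
have [ir | ir] /= := ltnP i (r + s); last first.
  by rewrite !(@sparse_mx0 0) ?mul0r ?subrr ?eqxx // -leqNgt //= (leq_trans ir) // ltnW.
have [jr | jr] /= := leqP r j; last first.
  by rewrite !(@sparse_mx0 1) ?mulr0 ?subrr ?eqxx // -ltnNge //= (ltn_trans ij).
have [a -> aE] := @sparse_mxP 0 i ir.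
have [b -> bE] := @sparse_mxP 1 j jr.
have neq (p q : 'I_M) : val (enum_val p) != val (enum_val q) -> (p == q) = false.
  by apply: contraNF => /eqP->.
apply/eqP => /(congr1 (mcoeff (U_(a) + U_(b)))) /eqP.
rewrite -mpolyXD mcoeffB mcoeffX eqxx mcoeff0.
suff -> : (X 0 j * X 1 i)@_(U_(a) + U_(b)) = 0 by rewrite subr0 oner_eq0.
have [nzj | /sparse_mx0->] := boolP (nz_entry r s (0 : 'I_2, j)); last first.
  by rewrite mul0r mcoeff0.
have [nzi | /sparse_mx0->] := boolP (nz_entry r s (1 : 'I_2, i)); last first.
  by rewrite mulr0 mcoeff0.
have [c -> cE] := sparse_mxP nzj; have [d -> dE] := sparse_mxP nzi.
rewrite -mpolyXD mcoeffX; case: eqP => // /mnmP/(_ a).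
have ca : (c == a) = false.
  by apply: neq; rewrite cE aE xpair_eqE /= -val_eqE /= gtn_eqF.
have da : (d == a) = false by apply: neq; rewrite dE aE.
by rewrite !mnmE eqxx ca da.
Qed.

Definition pr k : 'I_n * 'I_n := val (enum_val k).
Definition gen k := minor (pr k).1 (pr k).2.

Lemma pr_inj : injective pr.
Proof. by move=> k k' /val_inj/enum_val_inj. Qed.

Lemma prP k : [/\ ((pr k).1 < (pr k).2)%N, ((pr k).1 < r + s)%N & (r <= (pr k).2)%N].
Proof.
rewrite /pr; case: (enum_val k) => p /= /andP[lt_p].
by rewrite minor2_neq0 // => /andP[].
Qed.

Lemma gen_neq0 k : gen k != 0.
Proof. by have [*] := prP k; rewrite minor2_neq0 //; apply/andP. Qed.

Lemma prE i j : (i < j)%N -> (i < r + s)%N -> (r <= j)%N ->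
  exists2 k, pr k = (i, j) & y K r s i j = 'X_k.
Proof.
move=> ij ir jr.
have p : (i < j)%N && (minor i j != 0) by rewrite minor2_neq0 ?ij ?ir.
rewrite /y insubT; exists (enum_rank (Sub (i, j) p : yvar K n r s)) => //.
by rewrite /pr enum_rankK.
Qed.

Lemma y_cases i j : (i < j)%N ->
  (exists2 k, pr k = (i, j) & y K r s i j = 'X_k) \/
  y K r s i j = 0 /\ minor i j = 0.
Proof.
move=> ij; case/orP: (orbN (minor i j == 0)) => m0.
  by right; split; [rewrite /y insubN //= m0 andbF | apply/eqP].
left; have /andP[ir jr] : (i < r + s)%N && (r <= j)%N by rewrite -(minor2_neq0 ij).
exact: prE.
Qed.

Lemma phi_y i j : (i < j)%N -> phi (y K r s i j) = minor i j.
Proof.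
case/y_cases=> [[k kE ->] | [-> ->]]; last exact: comp_mpoly0.
by rewrite /phi comp_mpolyXU -tnth_nth tnth_mktuple -[val _]/(pr k) kE.
Qed.

Lemma phi_plucker (i j k l : 'I_n) : (i < j)%N -> (j < k)%N -> (k < l)%N ->
  phi (plucker K r s i j k l) = 0.
Proof.
move=> ij jk kl.
have ik := ltn_trans ij jk; have jl := ltn_trans jk kl; have il := ltn_trans ij jl.
have phi_y2 (a b : 'I_n) (ab : (a < b)%N) := etrans (phi_y ab) (minor2E a b).
exact: (@comp_plucker _ _ _ _ _ _ _ _ _ _ _ (X 0) (X 1) i j k l
  (phi_y2 _ _ ij) (phi_y2 _ _ kl) (phi_y2 _ _ ik) (phi_y2 _ _ jl)
  (phi_y2 _ _ il) (phi_y2 _ _ jk)).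
Qed.

Local Notation r1 := (fun k => nat_of_ord (pr k).1).
Local Notation r2 := (fun k => nat_of_ord (pr k).2).

Lemma pr_coord_inj k k' : r1 k = r1 k' -> r2 k = r2 k' -> k = k'.
Proof.
move=> e1 e2; apply: pr_inj; rewrite [pr k]surjective_pairing [pr k']surjective_pairing.
by congr pair; apply: val_inj.
Qed.

Lemma subr_addCA (V : zmodType) (x y z : V) : x - y + z = z - y + x.
Proof. by rewrite addrAC [x + z]addrC addrAC. Qed.

(** Up to a swap, an incomparable pair is nested: [a = (i, l)] and [b = (j, k)] with
    [i < j < k < l]. The bounds known for [a] and [b] make [(i, k)] and [(j, l)] indices of
    variables, whereas [y i j] or [y k l] may be zero. *)
Lemma plucker_exchange : exchange_law r1 r2 (@plucker_relations K n r s).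
Proof.
move=> a b; wlog ab : a b / (r1 a < r1 b)%N => [IH nab nba|].
  have [ab | ba] := ltnP (r1 a) (r1 b); first exact: IH.
  have ba' : (r1 b < r1 a)%N by move: nab nba ba; rewrite /cle /=; clear; lia.
  have [c [d [t [pl /andP[cb ca] wt tE]]]] := IH b a ba' nba nab.
  exists c, d, t; rewrite ['X_a * _]mulrC [(U_(a) + _)%MM]addmC ca cb; split=> //.
  case: tE => [|[e [g [tg /andP[eb ea] wt']]]]; [by left | right].
  by exists e, g; rewrite ea eb.
move=> nab nba.
have [a12 air rja] := prP a; have [b12 bir rjb] := prP b.
have ba : (r2 b < r2 a)%N by move: nab nba ab; rewrite /cle /=; clear; lia.
case aE: (pr a) => [i l] in ab nab nba a12 air rja ba *.
case bE: (pr b) => [j k] in ab nab nba b12 bir rjb ba *.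
rewrite /= in ab ba a12 air rja b12 bir rjb.
have [c cE yc] := prE (ltn_trans ab b12) air rjb.
have [d dE yd] := prE (ltn_trans b12 ba) bir rja.
have ya : y K r s i l = 'X_a.
  by have [a' a'E ->] := prE a12 air rja; congr 'X_(_); apply: pr_inj; rewrite aE.
have yb : y K r s j k = 'X_b.
  by have [b' b'E ->] := prE b12 bir rjb; congr 'X_(_); apply: pr_inj; rewrite bE.
exists c, d, (y K r s i j * y K r s k l); split.
- rewrite -ya -yb -yc -yd; exists i, j, k, l.
  by split; [exact: ab | exact: b12 | exact: ba | exact: subr_addCA].
- by rewrite /cle aE bE cE /= !leqnn (ltnW ab) (ltnW ba).
(* The two weights differ by [2 (j - i) (l - k)]. *)
- rewrite !weightD !weightU aE bE cE dE /=; move: ab b12 ba; clear; nia.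
case: (y_cases ab) => [[e eE ->] | [-> _]]; last by left; rewrite mul0r.
case: (y_cases ba) => [[g gE ->] | [-> _]]; last by left; rewrite mulr0.
right; exists e, g; split=> //.
  by rewrite /cle aE bE eE /= leqnn (ltnW ab) (ltnW b12) (ltnW (ltn_trans b12 ba)).
by rewrite !weightD !weightU aE bE eE gE /=; move: ab b12 ba; clear; nia.
Qed.

Lemma phi_plucker_relations p : @plucker_relations K n r s p -> phi p = 0.
Proof. by case=> i [j [k [l [ij jk kl ->]]]]; apply: phi_plucker. Qed.

Lemma sparse_mx_homog (p : 'I_2) j : X p j \is 1.-homog.
Proof.
have [/sparse_mxP[a -> _] | /sparse_mx0->] := boolP (nz_entry r s (p, j)).
  by rewrite dhomogX /= mdeg1.
exact: rpred0.
Qed.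

Lemma gen_homog k : gen k \is 2.-homog.
Proof.
by rewrite /gen minor2E; apply: rpredB;
  apply: (dhomogM (sparse_mx_homog _ _) (sparse_mx_homog _ _)).
Qed.

Lemma minors_gen k : @minors K n r s (gen k).
Proof. by exists (pr k).1, (pr k).2; split=> //; case: (prP k). Qed.

Lemma minors_cases p : @minors K n r s p -> p = 0 \/ exists k, p = gen k.
Proof.
case=> i [j [ij ->]]; case: (y_cases ij) => [[k kE _] | [_ ->]]; [right | by left].
by exists k; rewrite /gen kE.
Qed.

(** * Initial monomials of the minors under a diagonal order *)

Variable tau : rel 'X_{1..M}.
Hypothesis htau : diagonal_order K tau.

Lemma diagonal_leading : exists fa fb : 'I_N -> 'I_M,
  [/\ forall k k', (fa k == fa k') = (r1 k == r1 k'),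
      forall k k', (fb k == fb k') = (r2 k == r2 k'),
      forall k k', fa k != fb k'
    & forall k, leading tau (gen k) (U_(fa k) + U_(fb k))].
Proof.
have nz0 k : @nz_entry n r s (0 : 'I_2, (pr k).1) by case: (prP k).
have nz1 k : @nz_entry n r s (1 : 'I_2, (pr k).2) by case: (prP k).
have [fa faX faE] : exists2 fa : 'I_N -> 'I_M, forall k, X 0 (pr k).1 = 'X_(fa k)
    & forall k, val (enum_val (fa k)) = (0, (pr k).1).
  exact: fin_all_exists2 (fun k => sparse_mxP (nz0 k)).
have [fb fbX fbE] : exists2 fb : 'I_N -> 'I_M, forall k, X 1 (pr k).2 = 'X_(fb k)
    & forall k, val (enum_val (fb k)) = (1, (pr k).2).
  exact: fin_all_exists2 (fun k => sparse_mxP (nz1 k)).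
have eqE (a b : 'I_M) : (a == b) = (val (enum_val a) == val (enum_val b)).
  by rewrite (inj_eq val_inj) (inj_eq enum_val_inj).
exists fa, fb; split=> [k k'|k k'|k k'|k].
- by rewrite eqE !faE xpair_eqE.
- by rewrite eqE !fbE xpair_eqE.
- by rewrite eqE faE fbE xpair_eqE.
have lead := init_mnm_leading htau.1 (gen_neq0 k).
have [k12 _ _] := prP k.
have := htau.2 _ _ k12 (gen_neq0 k); rewrite faX fbX -mpolyXD.
(* Comparing one coefficient turns the equality of monomials as polynomials into an equality of
   exponents. *)
move/(congr1 (mcoeff (init_mnm tau (gen k))))/eqP; rewrite !mcoeffX eqxx.
by case: ((_ + _)%MM =P _) => [-> //|_]; rewrite oner_eq0.
Qed.

End SparseMinors.

Theorem corollary4p6 (K : fieldType) (n r s : nat)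
    (hn : (3 <= n)%N) (hr : (1 <= r)%N) (hrn : (r < n)%N)
    (hrs : (r + s <= n)%N) (hnrs : (n - r - s <= r)%N)
    (tau : rel 'X_{1..#|{: xvar n r s}|}) (htau : diagonal_order K tau) :
  [/\ (forall p : xring K n r s,
         init_alg tau (@fiber_I K n r s) p <-> fiber_in_I tau p),
      is_sagbi tau (@minors K n r s) (@fiber_I K n r s),
      (exists sigma : rel 'X_{1..#|{: yvar K n r s}|},
         term_order sigma /\
         is_groebner sigma (@plucker_relations K n r s) (@ker_phi K n r s))
    & koszul (@minors K n r s)].
Proof.
have [fa [fb [fa_inj fb_inj fafb lead]]] := diagonal_leading htau.
(* Linear independence of the images of standard monomials, used for both the Groebner basis and
   Koszulness. *)
have phi_inj := @phi_standard_inj _ _ _ _ _ _ (@pr_coord_inj K n r s) _ _ _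
  htau.1 fa_inj fb_inj fafb lead.
(* The initial monomials of the nonzero minors generate the initial algebra; the first two
   conclusions follow by comparing generating sets. *)
have init_gen := @init_alg_gen _ _ _ _ _ _ _ (@pr_coord_inj K n r s)
  (@plucker_exchange K n r s) (@phi_plucker_relations K n r s) _
  (@minors_gen K n r s) (@minors_cases K n r s) _ _ _
  htau.1 fa_inj fb_inj fafb lead.
split.
- move=> p; split=> [/init_gen|]; apply: alg_gen_sub => q.
    move=> [k ->]; apply: alg_gen_in; exists (pr k).1, (pr k).2.
    by split=> //; [case: (prP k) | apply: gen_neq0].
  move=> [i [j [ij m0 ->]]]; apply: alg_gen_in; exists (minor2 K r s i j).
  by split=> //; apply: alg_gen_in; exists i, j.
- split=> [p|p]; first exact: alg_gen_in.
  split=> [/init_gen|]; apply: alg_gen_sub => q.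
    move=> [k ->]; apply: alg_gen_in; exists (gen k).
    by split=> //; [apply: minors_gen | apply: gen_neq0].
  move=> [p' [Sp' p'0 ->]]; apply: alg_gen_in; exists p'.
  by split=> //; apply: alg_gen_in.
- exists (weight_le (fun k => nat_of_ord (pr k).1) (fun k => nat_of_ord (pr k).2)).
  split; first exact: weight_le_term.
  exact: (@plucker_groebner _ _ _ _ _ _ _
    (@plucker_exchange K n r s) (@phi_plucker_relations K n r s) phi_inj).
exact: (@koszul_gen _ _ _ _ _ _ _ (@pr_coord_inj K n r s)
  (@plucker_exchange K n r s) (@phi_plucker_relations K n r s) _
  (@minors_gen K n r s) (@minors_cases K n r s) phi_inj (@gen_homog K n r s)).
Qed.
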